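(* Let $d\ge1$, let $\xi=\xi(x)$, $x\in[0,1]^d$, be a separable real-valued random field, and let $\vec\alpha=(\alpha_1,\dots,\alpha_d)$ with constants $\alpha_k>0$. Suppose that $\theta_{\vec\alpha}$ is a $\Psi$-function with non-trivial support $(A,B)$ such that $$A=\inf\operatorname{supp}\theta_{\vec\alpha}\ge 1/\min_k\alpha_k,\qquad B=\sup\operatorname{supp}\theta_{\vec\alpha}\in(A,\infty].$$ Then for all $\vec\delta=(\delta_1,\dots,\delta_d)\in(0,1]^d$ $$\left|\Omega[\xi](\vec\delta)\right|_A\le\frac{\prod_{k=1}^d\delta_k^{\alpha_k}}{\phi\left(G\theta_{\vec\alpha},\prod_{k=1}^d\delta_k\right)}.$$
   Context: For a random variable $\eta$, $|\eta|_p=[\mathbf{E}|\eta|^p]^{1/p}$. Rectangle difference: for a function $f$ on $[0,1]^d$ and $x,y\in[0,1]^d$, $\Box[f](x,y)=\sum_{S\subseteq\{1,\dots,d\}}(-1)^{d-|S|}f(z^S)$, where $z^S_i=y_i$ for $i\in S$ and $z^S_i=x_i$ for $i\notin S$ (for $d=2$: $f(y_1,y_2)-f(x_1,y_2)-f(y_1,x_2)+f(x_1,x_2)$). Rectangle modulus of continuity: $\Omega[\xi](\vec\delta)=\sup\{|\Box[\xi](x,y)|:\ x,y\in[0,1]^d,\ |x_i-y_i|\le\delta_i,\ i=1,\dots,d\}$. The function $\theta_{\vec\alpha}$ is $$\theta_{\vec\alpha}(p)=8^d\cdot4^{d/p}\cdot\prod_{k=1}^d\left[\frac{\alpha_k+1/p}{\alpha_k-1/p}\right]\cdot\left[\int_{[0,1]^d}\int_{[0,1]^d}\frac{\mathbf{E}|\Box[\xi](x,y)|^p}{\prod_{k=1}^d|x_k-y_k|^{\alpha_kp+1}}\,dx\,dy\right]^{1/p}.$$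 $\Psi$-functions: for $1\le A<B\le\infty$, a $\Psi$-function with support $(A,B)$ is a function $\psi$ that is continuous and positive (finite) on the open interval $(A,B)$, satisfies $\inf_{p\in(A,B)}\psi(p)>0$, and is set equal to $\infty$ for $p\notin(A,B)$; $\operatorname{supp}\psi=(A,B)$. Fundamental function of the Grand Lebesgue space $G\psi$: for $\delta>0$, $\phi(G\psi,\delta)=\sup_{p\in\operatorname{supp}\psi}\delta^{1/p}/\psi(p)$.
   Formalization: ''Separable'' is strengthened to: jointly measurable, and a.s. every rectangle is a limit of rectangles from any given countable dense set with ξ converging at all corners; with Doob separability the claim fails, e.g. ξ(x)=1_{x=1/2}+cx, d=1, α=1/2, small c. *)

(* Defs.v *)
From HB Require Import structures.
From mathcomp Require Import all_boot all_order all_algebra.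
From mathcomp Require Import all_classical all_reals all_analysis.

Set Implicit Arguments.
Unset Strict Implicit.
Unset Printing Implicit Defensive.

Import Order.TTheory GRing.Theory Num.Theory.
Import numFieldNormedType.Exports.

Local Open Scope classical_set_scope.
Local Open Scope ring_scope.

Section unit_interval_measure.
Context (R : realType).

(* [mrestr lebesgue_measure `[0, 1]], transported from [measurableTypeR R] to
   the (convertible) Borel structure carried by [R] itself. *)
Definition unit_interval_measure : set R -> \bar R :=
  mrestr (@lebesgue_measure R) (measurable_itv `[0%R, 1%R]).

Let unit_interval_measure0 : unit_interval_measure set0 = 0%E.
Proof. exact: measure0. Qed.

Let unit_interval_measure_ge0 A : (0 <= unit_interval_measure A)%E.
Proof. exact: measure_ge0. Qed.

Let unit_interval_measure_sigma_additive :
  semi_sigma_additive unit_interval_measure.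
Proof.
exact: (@measure_semi_sigma_additive _ _ _
  (mrestr (@lebesgue_measure R) (measurable_itv `[0%R, 1%R]))).
Qed.

HB.instance Definition _ := isMeasure.Build _ _ _ unit_interval_measure
  unit_interval_measure0 unit_interval_measure_ge0
  unit_interval_measure_sigma_additive.

Lemma unit_interval_measure_setT : unit_interval_measure [set: R] = 1%E.
Proof.
rewrite /unit_interval_measure /mrestr setTI lebesgue_measure_itv/=.
by rewrite lte_fin ltr01 -EFinD subr0.
Qed.

HB.instance Definition _ :=
  @Measure_isProbability.Build _ _ _ unit_interval_measure
    unit_interval_measure_setT.

End unit_interval_measure.

Section cube_measure.
Context (R : realType).

Definition tuple_cons (n : nat) (z : R * n.-tuple R) : n.+1.-tuple R :=
  [tuple of z.1 :: z.2].

Lemma measurable_tuple_cons (n : nat) : measurable_fun setT (@tuple_cons n).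
Proof. exact: measurable_cons. Qed.

HB.instance Definition _ (n : nat) :=
  @isMeasurableFun.Build _ _ _ _ (@tuple_cons n) (@measurable_tuple_cons n).

(* Lebesgue measure of R^d restricted to [0,1]^d, as the d-fold product of the
   Lebesgue measure of [0,1]. *)
Fixpoint cube_measure (d : nat) : probability (d.-tuple R) R :=
  if d is n.+1 then
    distribution (@unit_interval_measure R \x cube_measure n)%E (@tuple_cons n)
  else \d_ [tuple].

End cube_measure.

Section rectangle_difference.
Context (R : realType) (d : nat).
Implicit Types (x y : d.-tuple R) (f : d.-tuple R -> R).

Definition unit_cube : set (d.-tuple R) :=
  [set x | forall k, 0 <= tnth x k <= 1].

Definition corner x y (S : {set 'I_d}) : d.-tuple R :=
  [tuple if k \in S then tnth y k else tnth x k | k < d].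

Definition rect_diff f x y : R :=
  \sum_(S : {set 'I_d}) (-1) ^+ (d - #|S|) * f (corner x y S).

End rectangle_difference.

Section random_field.
Context (R : realType) (disp : measure_display) (T : measurableType disp).
Context (P : probability T R) (d : nat).
Implicit Types (xi : d.-tuple R -> T -> R) (alpha delta : 'I_d -> R).

(* Values of [xi] off the unit cube are junk and are never used. *)
Definition measurable_field xi : Prop :=
  measurable_fun (@unit_cube R d `*` [set: T])
    (fun z : d.-tuple R * T => xi z.1 z.2).

Definition close_pair (e : R) (u v : d.-tuple R * d.-tuple R) : Prop :=
  forall k, `|tnth u.1 k - tnth v.1 k| < e /\ `|tnth u.2 k - tnth v.2 k| < e.

Definition countable_dense_pairs (D : set (d.-tuple R * d.-tuple R)) : Prop :=
  [/\ countable D, D `<=` @unit_cube R d `*` @unit_cube R d &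
      forall u, (@unit_cube R d `*` @unit_cube R d) u ->
        forall e, 0 < e -> exists2 v, D v & close_pair e u v].

(* Separability relative to every countable dense set ("well-separability"),
   required of the corners of a rectangle jointly: almost surely, each rectangle
   is the limit of rectangles of D along which xi converges at all 2^d corners.
   It holds for sample-continuous fields, and it implies Doob's separability,
   with the set of corners of any such D as separant.

   Doob's separability alone, relative to one unspecified separant, would not
   suffice for the moment bound on the rectangle modulus: for d = 1 the
   deterministic field xi(x) = 1_{x = 1/2} + c * x is Doob separable (take a
   separant containing 1/2), its jump is invisible to the Lebesgue integral in
   [theta], so that [theta] tends to 0 with c, whereas its modulus is at least
   1 - c for delta = 1.  For d >= 2, approximating the corners one at a time is
   not enough either: an isolated value of xi at the point (1/2, 1/2), hidden in
   the oscillations of sin (1 / (x_1 - 1/2)), does not break separability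
   relative to any dense set. *)
Definition separable_field xi : Prop :=
  forall D, countable_dense_pairs D ->
    {ae P, forall w, forall u, (@unit_cube R d `*` @unit_cube R d) u ->
       forall e, 0 < e ->
         exists v, [/\ D v, close_pair e u v &
           forall S, `|xi (corner u.1 u.2 S) w - xi (corner v.1 v.2 S) w| < e]}.

Definition rect_modulus xi delta (w : T) : \bar R :=
  ereal_sup [set `|rect_diff (xi^~ w) u.1 u.2|%:E | u in
    [set u | [/\ @unit_cube R d u.1, @unit_cube R d u.2 &
                 forall k, `|tnth u.1 k - tnth u.2 k| <= delta k]]].

(* The denominator vanishes only on the null set where x_k = y_k for some k. *)
Definition theta xi alpha (p : R) : \bar R :=
  ((8 ^+ d * 4 `^ (d%:R / p) *
    \prod_(k < d) ((alpha k + p^-1) / (alpha k - p^-1)))%:E *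
   (\int[cube_measure R d]_(x in @unit_cube R d)
      \int[cube_measure R d]_(y in @unit_cube R d)
      ('E_P[fun w => (`|rect_diff (xi^~ w) x y| `^ p)%R] *
       ((\prod_(k < d) `|tnth x k - tnth y k| `^ (alpha k * p + 1))^-1)%:E))
   `^ p^-1)%E.

End random_field.

Section Psi_functions.
Context (R : realType).
Implicit Types (psi : R -> \bar R) (A : R) (B : \bar R).

Definition supp psi : set R := [set p | (psi p < +oo)%E].

Definition is_Psi_function psi A B : Prop :=
  [/\ 1 <= A /\ (A%:E < B)%E,
      forall p, (A%:E < p%:E < B)%E -> {for p, continuous psi},
      forall p, (A%:E < p%:E < B)%E -> (0 < psi p < +oo)%E,
      (0 < ereal_inf [set psi p | p in [set p | A%:E < p%:E < B]])%E &
      forall p, ~~ (A%:E < p%:E < B)%E -> psi p = +oo%E].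

Definition set_oo_outside A B psi (p : R) : \bar R :=
  if (A%:E < p%:E < B)%E then psi p else +oo%E.

Definition fundamental_function psi (delta : R) : \bar R :=
  ereal_sup [set ((delta `^ p^-1)%:E / psi p)%E | p in supp psi].

End Psi_functions.

(* Main.v *)
Require Import Defs.
From mathcomp Require Import all_boot all_order all_algebra.
From mathcomp Require Import all_classical all_reals all_analysis.
From mathcomp Require Import measurable_realfun ring lra.

Import Order.TTheory GRing.Theory Num.Theory.
Import numFieldNormedType.Exports.

Local Open Scope classical_set_scope.
Local Open Scope ring_scope.

(** The field is controlled, one sample path at a time, by a multi-parameter
    Garsia-Rodemich-Rumsey (GRR) inequality: with q = 1/p < alpha_k,

      |Box f (x, y)| <= prod_k c_k |x_k - y_k|^(alpha_k - q) * G^q,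

    where G is the double integral of
    |Box f (u, v)|^p / prod_k |u_k - v_k|^(alpha_k p + 1) and
    c_k = 8 * 4^q * (alpha_k + q) / (alpha_k - q).  Applied to a path of xi, the
    p-th moment of the right-hand side is exactly theta(p)^p times a power of
    the side lengths, because Tonelli turns the expectation of G into the
    double integral inside theta.  Hence the norm of the modulus in L^A, which
    is at most its norm in L^p for p > A, is bounded by
    prod_k delta_k^(alpha_k - q) * theta(p), for each p in (A, B); the infimum
    over p of these bounds is the quotient by the fundamental function.

    Paths are only measurable, so the path inequality can hold no better than
    for almost every pair (x, y) ([rect_grr_ae]).  In dimension one
    ([grr_ae]) it comes from the classical chain of points t_n -> s chosen at
    geometric scales r_n.  Continuity of f at s is replaced by finiteness of
    J(s), the integral over t of |f s - f t|^p / |s - t|^(a p + 1): t_n can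
    be chosen such that, moreover, |f s - f t_n|^p <= C r_n^(a p) with C
    depending on J(s), and this tends to 0.  If G is finite then J(s) is
    finite for almost every s.  The higher dimensions follow by induction:
    Box f is a difference in the first coordinate of a rectangle difference in
    the others, and two bounds of Garsia-Rodemich-Rumsey form, one in each of
    two groups of variables, multiply ([ae_bound_tensor]).

    Separability enters once.  A set of full measure of pairs contains a
    countable dense set ([exists_dense_sequence]), so almost every path
    satisfies the bound on such a set, and the approximation of each rectangle
    by rectangles of that set carries the bound over to all rectangles
    ([rect_diff_le_of_dense]). *)

(** * Almost everywhere statements on product spaces *)

Section ae_product.
Context {d1 d2 : measure_display} {X : measurableType d1}
  {Y : measurableType d2} {R : realType}.
Context (m1 : probability X R) (m2 : probability Y R).
Local Open Scope ereal_scope.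

Lemma ae_integral_indic0 {d : measure_display} {T : measurableType d}
    (m : {measure set T -> \bar R}) (Q : set T) : measurable Q ->
  {ae m, forall x, Q x} <-> \int[m]_x (\1_(~` Q) x)%:E = 0.
Proof.
move=> mQ; have mQc := measurableC mQ.
rewrite integral_indic// setIT; split => [aeQ|Q0].
  by apply/(negligibleP _ mQc).
by apply/(negligibleP _ mQc).
Qed.

Let measurable_indicC (Q : set (X * Y)) : measurable Q ->
  measurable_fun setT (EFin \o (\1_(~` Q) : X * Y -> R)).
Proof.
move=> mQ; apply/measurable_EFinP.
exact/measurable_indic/measurableC.
Qed.

Let ae0_integral0 {d : measure_display} {T : measurableType d}
    (m : {measure set T -> \bar R}) (f : T -> \bar R) :
  measurable_fun setT f -> (forall x, 0 <= f x) ->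
  \int[m]_x f x = 0 <-> {ae m, forall x, f x = 0}.
Proof.
move=> mf f0; have := ae_eq_integral_abs m measurableT mf.
under eq_integral do rewrite gee0_abs//.
move=> [h1 h2]; split => [/h1|fae0].
  by apply: filterS => x /(_ I).
by apply: h2; apply: filterS fae0 => x + _.
Qed.

Lemma ae_prodP1 (Q : set (X * Y)) : measurable Q ->
  {ae m1 \x m2, forall z, Q z} <->
  {ae m1, forall x, {ae m2, forall y, Q (x, y)}}.
Proof.
move=> mQ; rewrite ae_integral_indic0//.
rewrite (fubini_tonelli1 (fun z => (\1_(~` Q) z)%:E)); last 2 first.
- exact: measurable_indicC.
- by move=> z; rewrite lee_fin.
rewrite ae0_integral0; last 2 first.
- apply: (measurable_fun_fubini_tonelli_F (fun z => (\1_(~` Q) z)%:E)).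
  + exact: measurable_indicC.
  + by move=> z; rewrite lee_fin.
- by move=> x; apply: integral_ge0 => y _; rewrite lee_fin.
have E x : fubini_F m2 (fun z => (\1_(~` Q) z)%:E) x = 0 <->
    {ae m2, forall y, Q (x, y)}.
  have mQx : measurable [set y | Q (x, y)].
    by rewrite -[X in measurable X]setTI; apply: (measurable_pair1 x).
  by rewrite (ae_integral_indic0 m2 _ mQx).
by split; apply: filterS => x /E.
Qed.

Lemma ae_prodP2 (Q : set (X * Y)) : measurable Q ->
  {ae m1 \x m2, forall z, Q z} <->
  {ae m2, forall y, {ae m1, forall x, Q (x, y)}}.
Proof.
move=> mQ; rewrite ae_integral_indic0//.
rewrite (fubini_tonelli2 (fun z => (\1_(~` Q) z)%:E)); last 2 first.
- exact: measurable_indicC.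
- by move=> z; rewrite lee_fin.
rewrite ae0_integral0; last 2 first.
- apply: (measurable_fun_fubini_tonelli_G (fun z => (\1_(~` Q) z)%:E)).
  + exact: measurable_indicC.
  + by move=> z; rewrite lee_fin.
- by move=> x; apply: integral_ge0 => y _; rewrite lee_fin.
have E y : fubini_G m1 (fun z => (\1_(~` Q) z)%:E) y = 0 <->
    {ae m1, forall x, Q (x, y)}.
  have mQy : measurable [set x | Q (x, y)].
    by rewrite -[X in measurable X]setTI; apply: (measurable_pair2 y).
  by rewrite (ae_integral_indic0 m1 _ mQy).
by split; apply: filterS => x /E.
Qed.

Lemma ae_swap (Q : set (X * Y)) : measurable Q ->
  {ae m1, forall x, {ae m2, forall y, Q (x, y)}} ->
  {ae m2, forall y, {ae m1, forall x, Q (x, y)}}.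
Proof. by move=> mQ /(ae_prodP1 _ mQ)/(ae_prodP2 _ mQ). Qed.

(** The bound in x, valid for each y, reduces F (x, y) to the weighted integral
    of F (., y); for almost every y, that integral is estimated with the bound
    in y, which holds at almost every of its points by [ae_swap]. *)
Lemma ae_bound_tensor (F : X * Y -> \bar R) (a A : X -> R) (b B : Y -> R) :
  measurable_fun setT F -> (forall z, 0 <= F z) ->
  measurable_fun setT a -> (forall x, 0 <= a x)%R ->
  measurable_fun setT b -> (forall y, 0 <= b y)%R ->
  measurable_fun setT A -> (forall x, 0 <= A x)%R ->
  measurable_fun setT B -> (forall y, 0 <= B y)%R ->
  (forall y, {ae m1, forall x,
    F (x, y) <= (A x)%:E * \int[m1]_x' (F (x', y) * (a x')%:E)}) ->
  (forall x, {ae m2, forall y,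
    F (x, y) <= (B y)%:E * \int[m2]_y' (F (x, y') * (b y')%:E)}) ->
  {ae m1 \x m2, forall z, F z <= (A z.1 * B z.2)%:E *
     \int[m1 \x m2]_z' (F z' * (a z'.1 * b z'.2)%:E)}.
Proof.
move=> mF F0 ma a0 mb b0 mA A0 mB B0 boundX boundY.
have mFb : measurable_fun setT (fun z : X * Y => F z * (b z.2)%:E).
  by apply: emeasurable_funM => //; apply/measurable_EFinP; exact: measurableT_comp.
have Fb0 z : 0 <= F z * (b z.2)%:E by rewrite mule_ge0// lee_fin.
have mFab : measurable_fun setT (fun z : X * Y => F z * (a z.1 * b z.2)%:E).
  apply: emeasurable_funM => //; apply/measurable_EFinP.
  by apply: measurable_funM; exact: measurableT_comp.
have Fab0 z : 0 <= F z * (a z.1 * b z.2)%:E.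
  by rewrite mule_ge0// lee_fin mulr_ge0.
pose J x := \int[m2]_y' (F (x, y') * (b y')%:E).
have mJ : measurable_fun setT J by apply: (measurable_fun_fubini_tonelli_F _ mFb).
have J0 x : 0 <= J x by apply: integral_ge0 => y _; exact: (Fb0 (x, y)).
set I := \int[m1 \x m2]_z' _.
have IE : I = \int[m1]_x (J x * (a x)%:E).
  rewrite /I fubini_tonelli1//; apply: eq_integral => x _.
  rewrite /fubini_F -ge0_integralZr//.
  - by apply: eq_integral => y _ /=; rewrite mulrC EFinM muleA.
  - exact: (measurableT_comp mFb (pair1_measurable x)).
  - by rewrite lee_fin.
have mBound2 : measurable
    [set z : X * Y | F z <= (B z.2)%:E * J z.1].
  rewrite -[X in measurable X]setTI; apply: measurable_lee => //.
  apply: emeasurable_funM; last exact: measurableT_comp.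
  by apply/measurable_EFinP; exact: measurableT_comp.
have mBound : measurable [set z : X * Y | F z <= (A z.1 * B z.2)%:E * I].
  rewrite -[X in measurable X]setTI; apply: measurable_lee => //.
  apply: emeasurable_funM => //; apply/measurable_EFinP.
  by apply: measurable_funM; exact: measurableT_comp.
apply/(ae_prodP2 _ mBound).
have := ae_swap _ mBound2 (aeW _ boundY).
apply: filterS => y aeb.
have le_int : \int[m1]_x' (F (x', y) * (a x')%:E) <= (B y)%:E * I.
  rewrite IE -ge0_integralZl//; last 3 first.
  - by apply: emeasurable_funM => //; exact/measurable_EFinP.
  - by move=> x _; rewrite mule_ge0// lee_fin.
  - by rewrite lee_fin.
  apply: ae_ge0_le_integral => //.
  - by move=> x _; rewrite mule_ge0// lee_fin.
  - apply: emeasurable_funM; last exact/measurable_EFinP.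
    exact: (measurableT_comp mF (pair2_measurable y)).
  - by move=> x _; rewrite !mule_ge0// lee_fin.
  - apply: emeasurable_funM => //; apply: emeasurable_funM => //.
    exact/measurable_EFinP.
  - apply: filterS aeb => x /= Fxy _.
    by rewrite muleA lee_wpmul2r// lee_fin.
apply: filterS (boundX y) => x /= /le_trans; apply.
by rewrite EFinM -muleA lee_wpmul2l// lee_fin.
Qed.

End ae_product.

(** * Points where several functions are below their averages *)

Section exists_below_average.
Context {disp : measure_display} {T : measurableType disp} {R : realType}.
Context (m : {measure set T -> \bar R}).

(** Otherwise the sum of the F i / b i, whose integral over D is less than n,
    would be at least n / r at each point of D, a set of measure r. *)
Lemma exists_lt_averages (n : nat) (D : set T) (r : R)
    (F : 'I_n -> T -> \bar R) (b : 'I_n -> R) :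
  (0 < n)%N -> measurable D -> 0 < r -> m D = r%:E ->
  (forall i, measurable_fun setT (F i)) -> (forall i x, (0 <= F i x)%E) ->
  (forall i, (\int[m]_x F i x < (b i)%:E)%E) ->
  exists2 t, D t & forall i, (F i t < (n%:R * b i / r)%:E)%E.
Proof.
move=> n0 mD r0 mDr mF F0 Fb; apply: contrapT => noT.
pose x i := fine (\int[m]_(y in D) F i y)%E.
have IF0 i : (0 <= \int[m]_(y in D) F i y)%E by apply: integral_ge0.
have IFb i : (\int[m]_(y in D) F i y < (b i)%:E)%E.
  by apply: le_lt_trans (Fb i); apply: ge0_subset_integral.
have xE i : (x i)%:E = (\int[m]_(y in D) F i y)%E.
  by rewrite fineK// ge0_fin_numE// (lt_le_trans (IFb i))// leey.
have xb i : x i < b i by rewrite -lte_fin xE.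
have x0 i : 0 <= x i by rewrite -lee_fin xE.
have b0 i : 0 < b i by rewrite (le_lt_trans (x0 i)).
have mFD i : measurable_fun D (F i) by apply: measurable_funTS.
have : ((n%:R)%:E <= \int[m]_(y in D) (\sum_(i < n) ((b i)^-1)%:E * F i y))%E.
  have <- : (\int[m]_(y in D) (n%:R / r)%:E = (n%:R)%:E)%E.
    by rewrite integral_cst// mDr -EFinM divfK// gt_eqF.
  apply: ge0_le_integral => //.
  - by move=> y _; rewrite lee_fin divr_ge0// ltW.
  - by apply: emeasurable_sum => i; exact: emeasurable_funM.
  move=> y Dy; apply: contrapT => /negP; rewrite -ltNge => sum_lt.
  apply: noT; exists y => // i; rewrite ltNge; apply/negP => Fy.
  move: sum_lt; rewrite ltNge => /negP; apply.
  rewrite (bigD1 i)//= -[leLHS]adde0; apply: leeD; last first.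
    by apply: sume_ge0 => j _; rewrite mule_ge0// lee_fin invr_ge0 ltW.
  apply: (@le_trans _ _ ((b i)^-1%:E * (n%:R * b i / r)%:E)%E).
    rewrite -EFinM lee_fin (_ : _ * _ = n%:R / r)//.
    by field; rewrite !gt_eqF.
  by rewrite lee_wpmul2l// lee_fin invr_ge0 ltW.
rewrite ge0_integral_sum//; last 2 first.
- by move=> i; exact: emeasurable_funM.
- by move=> i y _; rewrite mule_ge0// lee_fin invr_ge0 ltW.
under eq_bigr => i _.
  rewrite ge0_integralZl_EFin// ?invr_ge0 ?(ltW (b0 i))// -xE -EFinM.
  over.
rewrite sumEFin lee_fin leNgt => /negP; apply.
have -> : n%:R = \sum_(i < n) 1 :> R by rewrite sumr_const card_ord.
apply: ltr_sum => [|i _].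
  by apply/hasP; exists (Ordinal n0) => //; rewrite mem_index_enum.
by rewrite mulrC ltr_pdivrMr// mul1r.
Qed.

End exists_below_average.

(** * The constants of the Garsia-Rodemich-Rumsey inequality *)

Section powR_facts.
Context {R : realType}.
Implicit Types a p q r x y : R.

Lemma le_of_geometric_error (x y c z : R) : 0 <= z < 1 ->
  (forall n, x <= y + c * z ^+ n) -> x <= y.
Proof.
move=> /andP[z0 z1] xle.
have cv : (y + c * z ^+ n @[n --> \oo] --> y)%classic.
  rewrite -[X in _ --> X]addr0 -[X in _ --> _ + X](mulr0 c).
  apply: cvgD; first exact: cvg_cst.
  by apply: cvgMr; apply: cvg_expr; rewrite ger0_norm.
by apply: (cvgr_to_ge cv); apply: nearW.
Qed.

(** The left-hand side is the bound that [increment_le_grr_kernel] gives for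
    one step of the chain, from scale r to scale r * l. *)
Lemma grr_step_powR (a p q B l r : R) : q = p^-1 -> 0 < p ->
  0 < B -> 0 < l -> 0 < r ->
  (r `^ (a * p + 1) * (3 * (3 * B / r) / (r * l))) `^ q
    = (9 * B / l) `^ q * r `^ (a - q).
Proof.
move=> -> p0 B0 l0 r0.
have r0' : r != 0 by rewrite gt_eqF.
have -> : a * p + 1 = (a * p - 1) + 1 + 1 by ring.
rewrite (@powRD _ r (a * p - 1 + 1) 1) ?r0' ?implybT//.
rewrite (@powRD _ r (a * p - 1) 1) ?r0' ?implybT// !powRr1 ?ltW//.
rewrite (_ : _ * _ = 9 * B / l * r `^ (a * p - 1)); last first.
  by field; rewrite gt_eqF//= r0'.
rewrite powRM ?powR_ge0 ?divr_ge0 ?mulr_ge0 ?ltW//.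
by rewrite -powRrM mulrBl mul1r mulfK// gt_eqF.
Qed.

(** The same for the distance from the endpoint to a point of the chain: only
    one factor 1 / r is left, so that the bound vanishes with r. *)
Lemma grr_tail_powR (a p q C r : R) : q = p^-1 -> 0 < p ->
  0 <= C -> 0 < r ->
  (r `^ (a * p + 1) * (3 * C / r)) `^ q = (3 * C) `^ q * r `^ a.
Proof.
move=> -> p0 C0 r0.
have r0' : r != 0 by rewrite gt_eqF.
rewrite (@powRD _ r (a * p) 1) ?r0' ?implybT// powRr1 ?ltW//.
rewrite (_ : _ * _ = 3 * C * r `^ (a * p)); last by field.
rewrite powRM ?powR_ge0 ?mulr_ge0//.
by rewrite -powRrM mulfK// gt_eqF.
Qed.

Lemma expR_half_le : expR (2^-1) <= 16 / 9 :> R.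
Proof.
have -> : (2^-1 : R) = 8^-1 * 4 by field.
rewrite expRM powR_mulrn ?expR_ge0//.
have h : expR (8^-1) <= 8 / 7 :> R.
  have := @expR_ge1Dx R (- 8^-1).
  rewrite expRN => h.
  have E0 : 0 < expR (8^-1) :> R by exact: expR_gt0.
  rewrite -(ler_pM2r E0) mulVf ?gt_eqF// in h; lra.
apply: (@le_trans _ _ ((8 / 7) ^+ 4)); last lra.
by rewrite lerXn2r ?nnegrE ?expR_ge0.
Qed.

(** The ratio l of consecutive scales is such that l^(a - q) = 2 q / (a + q).
    The constant that the chain yields is l^(-q) / (1 - l^(a - q)): its
    denominator contributes the factor (a + q) / (a - q) of theta, and
    l^(-q) stays below the square root of e. *)
Definition grr_ratio (a q : R) := (2 * q / (a + q)) `^ (a - q)^-1.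

Lemma grr_ratio_gt0 a q : 0 < q -> 0 < a -> 0 < grr_ratio a q.
Proof. by move=> *; rewrite powR_gt0// divr_gt0 ?mulr_gt0 ?addr_gt0. Qed.

Lemma grr_ratio_powR a q : 0 < q -> q < a ->
  grr_ratio a q `^ (a - q) = 2 * q / (a + q).
Proof.
move=> q0 qa; rewrite -powRrM mulVf ?powRr1//; last by rewrite gt_eqF ?subr_gt0.
by rewrite divr_ge0 ?mulr_ge0 ?addr_ge0 ?ltW// (lt_trans q0).
Qed.

Lemma grr_ratio_lt1 a q : 0 < q -> q < a -> grr_ratio a q < 1.
Proof.
move=> q0 qa; have aq : 0 < a + q by lra.
rewrite (_ : 1 = 1 `^ (a - q)^-1); last by rewrite powR1.
apply: gt0_ltr_powR; rewrite ?invr_gt0 ?subr_gt0 ?nnegrE ?ltr_pdivrMr//.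
  by rewrite divr_ge0 ?mulr_ge0 ?ltW.
lra.
Qed.

(** The factor 2 counts the two endpoints.  The inequality amounts to
    2 * 9^q * e^(1/2) <= 8 * 4^q, which holds since (9 / 4)^q <= 9 / 4 for
    q <= 1 and e^(1/2) <= 16 / 9. *)
Lemma grr_constant_le (a q B : R) : 0 < q -> q <= 1 -> q < a -> 0 < B ->
  2 * ((9 * B / grr_ratio a q) `^ q / (1 - grr_ratio a q `^ (a - q)))
    <= 8 * 4 `^ q * ((a + q) / (a - q)) * B `^ q.
Proof.
move=> q0 q1 qa B0; rewrite grr_ratio_powR//.
have l0 : 0 < grr_ratio a q by rewrite grr_ratio_gt0// (lt_trans q0).
have b0 : 0 < a - q by rewrite subr_gt0.
have aq : 0 < a + q by lra.
have -> : 1 - 2 * q / (a + q) = (a - q) / (a + q).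
  by field; rewrite gt_eqF.
have [B0' l0'] := (ltW B0, ltW l0).
rewrite invf_div mulrA powRM ?invr_ge0 ?mulr_ge0// powRM//.
have ratio_le : (grr_ratio a q)^-1 `^ q <= 16 / 9.
  apply: le_trans expR_half_le.
  have y0 : 0 <= (a + q) / (2 * q) by rewrite divr_ge0 ?mulr_ge0 ?ltW.
  have -> : (grr_ratio a q)^-1 `^ q = ((a + q) / (2 * q)) `^ (q / (a - q)).
    rewrite /grr_ratio -powRN -powRrM -invf_div -(powR_inv1 y0) -powRrM.
    by congr powR; ring.
  (* 1 + y <= e^y with y = (a - q) / (2 q), raised to the power q / (a - q) *)
  have -> : (2^-1 : R) = ((a - q) / (2 * q)) * (q / (a - q)).
    by field; rewrite !gt_eqF.
  have le_expR : (a + q) / (2 * q) <= expR ((a - q) / (2 * q)).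
    rewrite (_ : (a + q) / _ = 1 + (a - q) / (2 * q)) ?expR_ge1Dx//.
    by field; rewrite gt_eqF.
  rewrite expRM; apply: ge0_ler_powR => //; rewrite ?nnegrE ?expR_ge0//.
  by rewrite divr_ge0 ?ltW.
have nine : 9 `^ q <= 9 / 4 * 4 `^ q :> R.
  have -> : (9 : R) `^ q = (9 / 4) `^ q * 4 `^ q.
    by rewrite -powRM; [congr powR; field|lra|lra].
  rewrite ler_wpM2r ?powR_ge0// ler1_powR//; lra.
have K0 : 0 <= (a + q) / (a - q) by rewrite divr_ge0 ?ltW.
have := ler_pM (powR_ge0 _ _) (powR_ge0 _ _) nine ratio_le.
set u := 9 `^ q; set v := _^-1 `^ q; set w := 4 `^ q; set b := B `^ q.
move=> uv; have b0' : 0 <= b by exact: powR_ge0.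
rewrite [leLHS](_ : _ = (2 * (u * v)) * (((a + q) / (a - q)) * b)); last by ring.
rewrite [leRHS](_ : _ = (8 * w) * (((a + q) / (a - q)) * b)); last by ring.
apply: ler_wpM2r; first exact: mulr_ge0.
by move: uv; set x := u * v => uv; lra.
Qed.

End powR_facts.

(** * The one-dimensional inequality for measurable functions *)

Lemma unit_interval_measure_itv {R : realType} (u v : R) :
  0 <= u -> u <= v -> v <= 1 ->
  (unit_interval_measure `[u, v]%classic : \bar R) = (v - u)%:E.
Proof.
move=> u0 uv v1; rewrite /= /unit_interval_measure /mrestr.
rewrite (_ : _ `&` _ = `[u, v]%classic); last first.
  apply/setIidPl => x /=; rewrite !in_itv/= => /andP[ux xv].
  by rewrite (le_trans u0 ux) (le_trans xv v1).
rewrite lebesgue_measure_itv/= lte_fin -EFinB.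
by case: ltgtP uv => // -> _; rewrite subrr.
Qed.

Section one_dimensional_grr.
Context {R : realType}.
Notation U := (@unit_interval_measure R : probability R R).
Context (g : R -> R) (mg : measurable_fun setT g).
Context (a p : R) (p1 : 1 <= p) (pa : p^-1 < a).
Notation q := (p^-1).

Definition grr_kernel (s t : R) : R :=
  `|g s - g t| `^ p * `|s - t| `^ (- (a * p + 1)).

Definition grr_kernel_integral (s : R) : \bar R := (\int[U]_t (grr_kernel s t)%:E)%E.

Let p0 : 0 < p. Proof. by rewrite (lt_le_trans ltr01). Qed.
Let q0 : 0 < q. Proof. by rewrite invr_gt0. Qed.
Let q1 : q <= 1. Proof. by rewrite invf_le1. Qed.
Let a0 : 0 < a. Proof. exact: lt_trans pa. Qed.

Let grr_kernel_ge0 s t : 0 <= grr_kernel s t.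
Proof. by rewrite mulr_ge0 ?powR_ge0. Qed.

Let measurable_grr_kernel :
  measurable_fun setT (fun z : R * R => (grr_kernel z.1 z.2)%:E).
Proof.
apply/measurable_EFinP; apply: measurable_funM.
  apply: (measurableT_comp (measurable_powR p)).
  apply: measurableT_comp => //.
  by apply: measurable_funB; exact: measurableT_comp.
apply: (measurableT_comp (measurable_powR _)).
by apply: measurableT_comp => //; exact: measurable_funB.
Qed.

Let measurable_grr_kernel_integral : measurable_fun setT grr_kernel_integral.
Proof.
apply: (measurable_fun_fubini_tonelli_F (fun z => (grr_kernel z.1 z.2)%:E)) => //.
by move=> z; rewrite lee_fin.
Qed.

Let measurable_grr_kernel_l s : measurable_fun setT (fun t => (grr_kernel s t)%:E).
Proof. exact: (measurableT_comp measurable_grr_kernel (pair1_measurable s)). Qed.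

Let grr_kernel_integral_ge0 s : (0 <= grr_kernel_integral s)%E.
Proof. by apply: integral_ge0 => t _; rewrite lee_fin. Qed.

Let increment_le_grr_kernel (s t rho c : R) :
  `|s - t| <= rho -> grr_kernel s t <= c ->
  `|g s - g t| <= (rho `^ (a * p + 1) * c) `^ q.
Proof.
move=> st grr_kernel_le.
have rho0 : 0 <= rho by rewrite (le_trans _ st).
have c0 : 0 <= c by rewrite (le_trans _ grr_kernel_le).
rewrite -[leLHS](@powRr1 R)// -[X in _ `^ X <= _](mulfV (lt0r_neq0 p0)) powRrM.
apply: ge0_ler_powR; rewrite ?nnegrE ?mulr_ge0 ?powR_ge0 ?(ltW q0)//.
have [->|s_neq_t] := eqVneq s t.
  by rewrite subrr normr0 powR0 ?gt_eqF// mulr_ge0 ?powR_ge0.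
have w0 : 0 < `|s - t| `^ (a * p + 1) by rewrite powR_gt0 ?normr_gt0 ?subr_eq0.
apply: (@le_trans _ _ (`|s - t| `^ (a * p + 1) * grr_kernel s t)).
  by rewrite /grr_kernel powRN mulrCA mulfV ?mulr1// gt_eqF.
apply: ler_pM; rewrite ?powR_ge0//.
by apply: ge0_ler_powR; rewrite ?nnegrE// addr_ge0// mulr_ge0// ltW.
Qed.

(** A chain of points t_n in I n is built from t_0 towards s.  Its next point
    is chosen below the averages, over I n.+1, of three functions: the integral
    of the kernel, which allows the construction to go on; the kernel at
    (t_n, .), which bounds the step; and the kernel at (s, .), which ensures
    that g (t_n) tends to g s.  The factor 3 is the number of these functions. *)
Lemma grr_chain (B delta lam s t0 : R) (I : nat -> set R) :
  (\int[U]_t grr_kernel_integral t < B%:E)%E ->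
  0 < delta -> 0 < lam < 1 ->
  (forall n, measurable (I n)) ->
  (forall n, U (I n) = (delta * lam ^+ n)%:E) ->
  (forall n t, I n t -> `|s - t| <= delta * lam ^+ n) ->
  (forall n t u, I n t -> I n.+1 u -> `|t - u| <= delta * lam ^+ n) ->
  (grr_kernel_integral s < +oo)%E ->
  I 0%N t0 -> (grr_kernel_integral t0 < (3 * B / delta)%:E)%E ->
  `|g s - g t0| <=
    (9 * B / lam) `^ q / (1 - lam `^ (a - q)) * delta `^ (a - q).
Proof.
move=> JB delta0 /andP[lam0 lam1] mI UI Is It Js It0 Jt0.
pose r n := delta * lam ^+ n.
have r0 n : 0 < r n by rewrite mulr_gt0// exprn_gt0.
have B0 : 0 < B.
  by rewrite -lte_fin (le_lt_trans _ JB)//; exact: integral_ge0.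
pose M := (9 * B / lam) `^ q.
have M0 : 0 <= M by exact: powR_ge0.
pose C := fine (grr_kernel_integral s) + 1.
have JsE : grr_kernel_integral s = (fine (grr_kernel_integral s))%:E.
  by rewrite fineK// ge0_fin_numE.
have JsC : (grr_kernel_integral s < C%:E)%E by rewrite JsE lte_fin ltrDl.
have C0 : 0 <= C by rewrite -lee_fin (le_trans _ (ltW JsC)).
have rS n : r n.+1 = r n * lam by rewrite /r exprSr mulrA.
have chain n : exists t, [/\ I n t, (grr_kernel_integral t < (3 * B / r n)%:E)%E,
    `|g t0 - g t| <= \sum_(i < n) M * r i `^ (a - q) &
    (0 < n)%N -> grr_kernel s t < 3 * C / r n].
  elim: n => [|n [t [Int Jt gt _]]].
    exists t0; split => //; first by rewrite /r expr0 mulr1.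
    by rewrite subrr normr0 big_ord0.
  pose F (i : 'I_3) := match val i with
    | 0%N => grr_kernel_integral
    | 1%N => (fun u => (grr_kernel t u)%:E)
    | _ => (fun u => (grr_kernel s u)%:E)
    end.
  pose b (i : 'I_3) := match val i with
    | 0%N => B
    | 1%N => 3 * B / r n
    | _ => C
    end.
  have [|||||||u Iu Fu] := @exists_lt_averages _ _ _ U 3 (I n.+1) (r n.+1) F b.
  - by [].
  - exact: mI.
  - exact: r0.
  - exact: UI.
  - by case=> [[|[|[|]]]] // i; rewrite /F/=.
  - by case=> [[|[|[|]]]] // i x; rewrite /F/= ?lee_fin.
  - by case=> [[|[|[|]]]] // i; rewrite /F/b/=.
  have := Fu (@Ordinal 3 0 isT); have := Fu (@Ordinal 3 1 isT).
  have := Fu (@Ordinal 3 2 isT).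
  rewrite /F/b/= => Fu2 Fu1 Fu0.
  exists u; split => //.
  rewrite big_ord_recr/=; apply: le_trans (ler_distD (g t) _ _) _.
  apply: lerD => //.
  rewrite -(@grr_step_powR _ a p q B lam (r n))//.
  apply: increment_le_grr_kernel; first exact: It Int Iu.
  by rewrite -rS ltW// -lte_fin.
have sum_le n : \sum_(i < n) M * r i `^ (a - q)
    <= M / (1 - lam `^ (a - q)) * delta `^ (a - q).
  set x := lam `^ (a - q).
  have x1 : x < 1.
    rewrite (_ : 1 = 1 `^ (a - q)); last by rewrite powR1.
    by apply: gt0_ltr_powR; rewrite ?nnegrE ?subr_gt0 ?(ltW lam0).
  have x0 : 0 < x by exact: powR_gt0.
  have rE i : M * r i `^ (a - q) = (M * delta `^ (a - q)) * x ^+ i.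
    rewrite /r powRM ?exprn_ge0 ?(ltW lam0) ?(ltW delta0)// -mulrA.
    by rewrite -powR_mulrn ?(ltW lam0)// powRAC powR_mulrn// ltW.
  under eq_bigr do rewrite rE.
  rewrite mulrAC.
  have := @geometric_le_lim R n (M * delta `^ (a - q)) x.
  rewrite /series/= big_mkord; apply => //.
    by rewrite mulr_ge0 ?powR_ge0.
  by rewrite ger0_norm// ltW.
apply: (@le_of_geometric_error _ _ _ ((3 * C) `^ q * (delta * lam) `^ a) (lam `^ a)).
  rewrite powR_ge0/= (_ : 1 = 1 `^ a); last by rewrite powR1.
  by apply: gt0_ltr_powR; rewrite ?nnegrE ?(ltW lam0).
move=> n; have [t [Int Jt gt /(_ isT) grr_kernel_st]] := chain n.+1.
have gst : `|g s - g t| <= (3 * C) `^ q * (delta * lam) `^ a * (lam `^ a) ^+ n.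
  have -> : (3 * C) `^ q * (delta * lam) `^ a * (lam `^ a) ^+ n =
      (3 * C) `^ q * r n.+1 `^ a.
    rewrite -mulrA; congr (_ * _).
    rewrite -powR_mulrn ?powR_ge0// powRAC powR_mulrn ?(ltW lam0)//.
    by rewrite -powRM ?mulr_ge0 ?exprn_ge0 ?(ltW lam0) ?(ltW delta0)// -mulrA -exprS.
  rewrite -(@grr_tail_powR _ a p q C (r n.+1))//.
  by apply: increment_le_grr_kernel; [exact: Is|exact: ltW].
apply: le_trans (ler_distD (g t) _ _) _; rewrite addrC.
apply: lerD => //.
by rewrite distrC (le_trans gt).
Qed.

Let U_itv (u v : R) : 0 <= u -> u <= v -> v <= 1 ->
  U `[u, v]%classic = (v - u)%:E.
Proof. exact: unit_interval_measure_itv. Qed.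

Definition grr_const : R := 8 * 4 `^ q * ((a + q) / (a - q)).

(** Two chains, towards s and towards t, start at a common point of [s, t]. *)
Let increment_le_grr_kernel_integral (B s t : R) :
  (\int[U]_x grr_kernel_integral x < B%:E)%E ->
  0 <= s -> s < t -> t <= 1 ->
  (grr_kernel_integral s < +oo)%E -> (grr_kernel_integral t < +oo)%E ->
  `|g s - g t| <= grr_const * B `^ q * (t - s) `^ (a - q).
Proof.
move=> JB s0 st t1 Js Jt.
pose delta := t - s.
have delta0 : 0 < delta by rewrite subr_gt0.
pose lam := grr_ratio a q.
have lam0 : 0 < lam by exact: grr_ratio_gt0.
have lam1 : lam < 1 by exact: grr_ratio_lt1.
have B0 : 0 < B.
  by rewrite -lte_fin (le_lt_trans _ JB)//; exact: integral_ge0.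
have r_le n : 0 <= delta * lam ^+ n <= delta.
  rewrite mulr_ge0 ?exprn_ge0 ?(ltW delta0) ?(ltW lam0)//=.
  by rewrite ler_piMr ?(ltW delta0)// exprn_ile1 ?(ltW lam0) ?(ltW lam1).
have r_dec n : delta * lam ^+ n.+1 <= delta * lam ^+ n.
  rewrite ler_wpM2l ?(ltW delta0)// exprS ler_piMl ?(ltW lam1)//.
  by rewrite exprn_ge0// ltW.
pose I n := `[s, s + delta * lam ^+ n]%classic.
pose I' n := `[t - delta * lam ^+ n, t]%classic.
have [|||||||t0 It0 Jt0] := @exists_lt_averages _ _ _ U 1 `[s, t]%classic delta
    (fun=> grr_kernel_integral) (fun=> B).
- by [].
- by [].
- by [].
- by apply: unit_interval_measure_itv; rewrite ?(ltW st).
- by [].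
- by [].
- by [].
have {}Jt0 : (grr_kernel_integral t0 < (3 * B / delta)%:E)%E.
  apply: (lt_trans (Jt0 ord0)); rewrite lte_fin.
  by rewrite ltr_pM2r ?invr_gt0// ltr_pM2r// ltr_nat.
have gs : `|g s - g t0| <=
    (9 * B / lam) `^ q / (1 - lam `^ (a - q)) * delta `^ (a - q).
  apply: (@grr_chain B delta lam s t0 I) => //.
  - by rewrite lam0.
  - by move=> n; exact: measurable_itv.
  - move=> n; have /andP[? ?] := r_le n.
    rewrite U_itv//.
    + by rewrite addrAC subrr add0r.
    + by rewrite lerDl.
    + by rewrite (le_trans _ t1)// -lerBrDl.
  - move=> n u; rewrite /I/= in_itv/= => /andP[su us].
    by rewrite distrC ger0_norm ?subr_ge0// lerBlDl.
  - move=> n u v; rewrite /I/= !in_itv/= => /andP[su us] /andP[sv vs].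
    have := r_dec n => rd.
    by rewrite ler_norml; apply/andP; split; lra.
  - by rewrite /I expr0 mulr1 /delta addrC subrK.
have gt : `|g t - g t0| <=
    (9 * B / lam) `^ q / (1 - lam `^ (a - q)) * delta `^ (a - q).
  apply: (@grr_chain B delta lam t t0 I') => //.
  - by rewrite lam0.
  - by move=> n; exact: measurable_itv.
  - move=> n; have /andP[? r_delta] := r_le n.
    rewrite U_itv//.
    + by rewrite opprB addrC subrK.
    + by rewrite subr_ge0 (le_trans r_delta)// /delta lerBlDr lerDl.
    + by rewrite lerBlDr lerDl.
  - move=> n u; rewrite /I'/= in_itv/= => /andP[tu ut].
    by rewrite ger0_norm ?subr_ge0// lerBlDl -lerBlDr.
  - move=> n u v; rewrite /I'/= !in_itv/= => /andP[su us] /andP[sv vs].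
    have := r_dec n => rd.
    by rewrite ler_norml; apply/andP; split; lra.
  - by rewrite /I' expr0 mulr1 /delta opprB addrC subrK.
apply: le_trans (ler_distD (g t0) _ _) _; rewrite (distrC (g t0)).
apply: le_trans (lerD gs gt) _.
rewrite -mulrDl; apply: ler_wpM2r; first exact: powR_ge0.
by rewrite -mulr2n -[leLHS]mulr_natl; exact: grr_constant_le.
Qed.

Lemma grr_const_gt0 : 0 < grr_const.
Proof.
by rewrite !mulr_gt0 ?powR_gt0 ?invr_gt0 ?subr_gt0 ?addr_gt0.
Qed.

Let grr_kernel_double_integral :
  (\int[U]_s grr_kernel_integral s = \int[U \x U]_z (grr_kernel z.1 z.2)%:E)%E.
Proof. by rewrite fubini_tonelli1// => z; rewrite lee_fin. Qed.

Let powR_increment_le (s t : R) :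
  0 <= s <= 1 -> 0 <= t <= 1 ->
  (grr_kernel_integral s < +oo)%E -> (grr_kernel_integral t < +oo)%E ->
  ((`|g s - g t| `^ p)%:E <=
    (grr_const `^ p * `|s - t| `^ (a * p - 1))%:E *
    \int[U]_x grr_kernel_integral x)%E.
Proof.
wlog st : s t / s < t => [hw|].
  case: (ltgtP s t) => [st||<-].
  - exact: hw.
  - by rewrite distrC (distrC s) => ts s01 t01 Js Jt; exact: hw.
  - move=> _ _ _ _; rewrite subrr normr0 powR0 ?gt_eqF// mule_ge0//.
      by rewrite lee_fin mulr_ge0 ?powR_ge0.
    exact: integral_ge0.
move=> /andP[s0 _] /andP[_ t1] Js Jt.
have K0 : 0 < grr_const `^ p * `|s - t| `^ (a * p - 1).
  rewrite mulr_gt0// powR_gt0 ?grr_const_gt0//.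
  by rewrite normr_gt0 subr_eq0 lt_eqF.
have I0 : (0 <= \int[U]_x grr_kernel_integral x)%E by exact: integral_ge0.
have [Ioo|] := eqVneq (\int[U]_x grr_kernel_integral x)%E +oo%E.
  by rewrite Ioo gt0_muley ?lte_fin// leey.
rewrite -ltey => Ifin.
have IE : (\int[U]_x grr_kernel_integral x)%E =
    (fine (\int[U]_x grr_kernel_integral x)%E)%:E.
  by rewrite fineK// ge0_fin_numE.
rewrite IE -EFinM lee_fin mulrC -ler_pdivrMr//.
(* the chain needs a strict upper bound of the double integral *)
apply/ler_addgt0Pr => e e0; rewrite ler_pdivrMr//.
set B := (X in X * _).
have B0 : 0 <= B by rewrite addr_ge0 ?fine_ge0// ltW.
have : `|g s - g t| <= grr_const * B `^ q * (t - s) `^ (a - q).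
  by apply: increment_le_grr_kernel_integral; rewrite ?(ltW st)// IE lte_fin ltrDl.
have c0 := ltW grr_const_gt0.
have cB0 : 0 <= grr_const * B `^ q by rewrite mulr_ge0// powR_ge0.
have cBd0 : 0 <= grr_const * B `^ q * (t - s) `^ (a - q).
  by rewrite mulr_ge0// powR_ge0.
move/(@ge0_ler_powR R p (ltW p0)); rewrite !nnegrE normr_ge0 cBd0.
move=> /(_ isT isT)/le_trans; apply.
rewrite (powRM _ cB0) ?powR_ge0// (powRM _ c0) ?powR_ge0//.
rewrite -!powRrM mulVf ?gt_eqF// powRr1// mulrBl mulVf ?gt_eqF//.
rewrite distrC ger0_norm ?subr_ge0 ?(ltW st)//.
by rewrite mulrAC mulrC.
Qed.

(** When the right-hand side is finite, the inequality holds for all s and t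
    of [0, 1] at which the integral of the kernel is finite. *)
Lemma grr_ae : {ae (U \x U)%E, forall s, ((`|g s.1 - g s.2| `^ p)%:E <=
    (grr_const `^ p * `|s.1 - s.2| `^ (a * p - 1))%:E *
    \int[U \x U]_t ((`|g t.1 - g t.2| `^ p)%:E *
       (`|t.1 - t.2| `^ (- (a * p + 1)))%:E))%E}.
Proof.
rewrite (_ : \int[_]_t _ = \int[U]_x grr_kernel_integral x)%E; last first.
  by rewrite grr_kernel_double_integral; apply: eq_integral => z _; rewrite -EFinM.
set K := (\int[U]_x _)%E.
have K0 : (0 <= K)%E by exact: integral_ge0.
have mQ : measurable [set s : R * R | ((`|g s.1 - g s.2| `^ p)%:E <=
    (grr_const `^ p * `|s.1 - s.2| `^ (a * p - 1))%:E * K)%E].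
  rewrite -[X in measurable X]setTI; apply: measurable_lee => //.
    apply/measurable_EFinP/(measurableT_comp (measurable_powR p)).
    apply: measurableT_comp => //.
    by apply: measurable_funB; exact: measurableT_comp.
  apply: emeasurable_funM => //; apply/measurable_EFinP.
  apply: measurable_funM => //.
  apply: (measurableT_comp (measurable_powR _)).
  by apply: measurableT_comp => //; exact: measurable_funB.
apply/(ae_prodP1 _ _ _ mQ) => /=.
have [Koo|] := eqVneq K +oo%E.
  apply: aeW => s; apply: aeW => t.
  have [->|st] := eqVneq s t.
    rewrite subrr normr0 powR0 ?gt_eqF// mule_ge0//.
    by rewrite lee_fin mulr_ge0 ?powR_ge0.
  rewrite Koo gt0_muley ?leey// lte_fin mulr_gt0// powR_gt0 ?grr_const_gt0//.
  by rewrite normr_gt0 subr_eq0.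
rewrite -ltey => Kfin.
have Jfin : {ae U, forall s, (grr_kernel_integral s < +oo)%E}.
  have /integrable_ae : U.-integrable setT grr_kernel_integral.
    apply/integrableP; split => //.
    by under eq_integral do rewrite gee0_abs//.
  move=> /(_ measurableT); apply: filterS => s /(_ I).
  by rewrite ge0_fin_numE.
have in01 : {ae U, forall s : R, 0 <= s <= 1}.
  exists (~` `[0, 1]%classic); split.
  - by apply: measurableC; exact: measurable_itv.
  - by rewrite /= /unit_interval_measure /mrestr setICl measure0.
  - by move=> s /= s01 ; rewrite in_itv.
have good : {ae U, forall s : R, 0 <= s <= 1 /\ (grr_kernel_integral s < +oo)%E}.
  by apply: filterS2 in01 Jfin => s.
apply: filterS (good) => s [s01 Js]; apply: filterS (good) => t [t01 Jt].
exact: powR_increment_le.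
Qed.

End one_dimensional_grr.

(** * Rectangle differences, coordinate by coordinate *)

Section rect_diff_theory.
Context {R : realType}.

Lemma lift0_imset_setP (d : nat) (S : {set 'I_d}) (j : 'I_d) :
  (lift ord0 j \in (lift ord0 @: S)%SET) = (j \in S).
Proof. by rewrite mem_imset//; exact: lift_inj. Qed.

Lemma ord0_notin_lift (d : nat) (S : {set 'I_d}) :
  (ord0 \in (lift ord0 @: S)%SET) = false.
Proof. by apply/negbTE/negP => /imsetP[i _] /eqP; rewrite (negbTE (neq_lift _ _)). Qed.

Lemma big_set_ordS (d : nat) (V : nmodType) (G : {set 'I_d.+1} -> V) :
  \sum_(S : {set 'I_d.+1}) G S =
  \sum_(S : {set 'I_d}) G (lift ord0 @: S)%SET +
  \sum_(S : {set 'I_d}) G (ord0 |: lift ord0 @: S)%SET.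
Proof.
rewrite (bigID (fun S : {set 'I_d.+1} => ord0 \in S))/= addrC; congr (_ + _).
- rewrite (reindex_onto (fun S : {set 'I_d} => (lift ord0 @: S)%SET)
    (fun S => [set i | lift ord0 i \in S]%SET))/=; last first.
    move=> S S0; apply/setP => i; case: (unliftP ord0 i) => [j|] ->.
      by rewrite lift0_imset_setP inE.
    by rewrite ord0_notin_lift (negbTE S0).
  apply: eq_bigl => S; rewrite ord0_notin_lift/=.
  by apply/eqP/setP => i; rewrite inE lift0_imset_setP.
- rewrite (reindex_onto (fun S : {set 'I_d} => (ord0 |: lift ord0 @: S)%SET)
    (fun S => [set i | lift ord0 i \in S]%SET))/=; last first.
    move=> S S0; apply/setP => i; case: (unliftP ord0 i) => [j|] ->.
      by rewrite !inE lift0_imset_setP inE eq_sym (negbTE (neq_lift _ _)).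
    by rewrite !inE eqxx S0.
  apply: eq_bigl => S; rewrite !inE eqxx/=.
  apply/eqP/setP => i; rewrite !inE lift0_imset_setP.
  by rewrite eq_sym (negbTE (neq_lift _ _)).
Qed.

Lemma corner_cons (d : nat) (s t : R) (x y : d.-tuple R) (S : {set 'I_d}) :
  corner (tuple_cons (s, x)) (tuple_cons (t, y)) (lift ord0 @: S)%SET
  = tuple_cons (s, corner x y S).
Proof.
apply: eq_from_tnth => i; rewrite tnth_mktuple.
case: (unliftP ord0 i) => [j|] ->.
  by rewrite lift0_imset_setP !tnthS tnth_mktuple.
by rewrite ord0_notin_lift !tnth0.
Qed.

Lemma corner_cons_ord0 (d : nat) (s t : R) (x y : d.-tuple R) (S : {set 'I_d}) :
  corner (tuple_cons (s, x)) (tuple_cons (t, y))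
    (ord0 |: lift ord0 @: S)%SET
  = tuple_cons (t, corner x y S).
Proof.
apply: eq_from_tnth => i; rewrite tnth_mktuple !inE.
case: (unliftP ord0 i) => [j|] ->.
  by rewrite lift0_imset_setP eq_sym (negbTE (neq_lift _ _))/= !tnthS tnth_mktuple.
by rewrite eqxx/= !tnth0.
Qed.

(** Rectangle differences are iterated differences, one coordinate after the
    other. *)
Lemma rect_diff_cons (d : nat) (f : d.+1.-tuple R -> R) (s t : R)
    (x y : d.-tuple R) :
  rect_diff f (tuple_cons (s, x)) (tuple_cons (t, y)) =
  rect_diff (fun x' => f (tuple_cons (t, x'))) x y -
  rect_diff (fun x' => f (tuple_cons (s, x'))) x y.
Proof.
rewrite /rect_diff big_set_ordS addrC; congr (_ + _).
  apply: eq_bigr => S _; rewrite corner_cons_ord0 cardsU1 ord0_notin_lift/=.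
  by rewrite card_imset; [rewrite subSS|exact: lift_inj].
rewrite -sumrN; apply: eq_bigr => S _; rewrite corner_cons.
rewrite card_imset; last exact: lift_inj.
rewrite subSn ?exprS ?mulN1r ?mulNr//.
by rewrite -[leqRHS]card_ord max_card.
Qed.

Lemma rect_diffB (d : nat) (f h : d.-tuple R -> R) (x y : d.-tuple R) :
  rect_diff (fun x' => f x' - h x') x y = rect_diff f x y - rect_diff h x y.
Proof.
by rewrite /rect_diff -sumrB; apply: eq_bigr => S _; rewrite mulrBr.
Qed.

Lemma measurable_corner (d : nat) (S : {set 'I_d}) :
  measurable_fun setT
    (fun z : d.-tuple R * d.-tuple R => corner z.1 z.2 S).
Proof.
apply/measurable_fun_tnthP => i.
rewrite (_ : _ \o _ = fun z : d.-tuple R * d.-tuple R =>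
    if i \in S then tnth z.2 i else tnth z.1 i); last first.
  by apply/funext => z /=; rewrite tnth_mktuple.
by case: (i \in S); apply: (measurableT_comp (@measurable_tnth _ R d i)).
Qed.

Lemma measurable_rect_diff {disp : measure_display} {T : measurableType disp}
    (d : nat) (h : d.-tuple R * T -> R) : measurable_fun setT h ->
  measurable_fun setT (fun u : (d.-tuple R * d.-tuple R) * T =>
    rect_diff (fun x => h (x, u.2)) u.1.1 u.1.2).
Proof.
move=> mh; apply: measurable_sum => S.
apply: measurable_funM => //.
apply: (measurableT_comp mh); apply/measurable_fun_pairP; split => //=.
- by apply: (measurableT_comp (measurable_corner d S)).
- exact: measurable_snd.
Qed.

Lemma measurable_rect_diff_det (d : nat) (f : d.-tuple R -> R) :
  measurable_fun setT f ->
  measurable_fun setT (fun z : d.-tuple R * d.-tuple R => rect_diff f z.1 z.2).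
Proof.
move=> mf; apply: measurable_sum => S; apply: measurable_funM => //.
by apply: (measurableT_comp mf); exact: measurable_corner.
Qed.

End rect_diff_theory.

(** * Splitting off the first coordinate of a pair of points of the cube *)

Definition square_prob {d : measure_display} {X : measurableType d}
  {R : realType} (m : probability X R) : probability (X * X)%type R := (m \x m)%E.

Section tonelli_exchange.
Context {d1 d2 : measure_display} {X : measurableType d1}
  {Y : measurableType d2} {R : realType}.
Context (m1 : probability X R) (m2 : probability Y R).
Local Open Scope ereal_scope.

(** The two points of a pair (s :: x, t :: y) come in the order s, x, t, y, but
    the induction on the dimension needs s and t together. *)
Lemma tonelli_exchange (h : (X * X) * (Y * Y) -> \bar R) :
  measurable_fun setT h -> (forall u, 0 <= h u) ->
  \int[square_prob m1 \x square_prob m2]_u h u =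
  \int[m1]_s \int[m2]_x \int[m1]_t \int[m2]_y h ((s, t), (x, y)).
Proof.
move=> mh h0.
have mF := measurable_fun_fubini_tonelli_F (m2 := square_prob m2) h mh h0.
have F0 s : 0 <= fubini_F (square_prob m2) h s by exact: integral_ge0.
transitivity (\int[square_prob m1]_s fubini_F (square_prob m2) h s).
  exact: fubini_tonelli1.
rewrite (fubini_tonelli1 _ mF F0).
apply: eq_integral => s _; rewrite /fubini_F.
pose k (v : X * Y) (y : Y) := h ((s, v.1), (v.2, y)).
have mk : measurable_fun setT (fun v : (X * Y) * Y => k v.1 v.2).
  rewrite /k; apply: (measurableT_comp mh).
  apply/measurable_fun_pairP; split.
    apply/measurable_fun_pairP; split; first exact: measurable_cst.
    exact: (measurableT_comp measurable_fst measurable_fst).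
  apply/measurable_fun_pairP; split; last exact: measurable_snd.
  exact: (measurableT_comp measurable_snd measurable_fst).
transitivity (\int[m1]_t \int[m2]_x \int[m2]_y k (t, x) y).
  apply: eq_integral => t _; rewrite fubini_tonelli1//.
  exact: (measurableT_comp mh (pair1_measurable (s, t))).
rewrite (fubini_tonelli (fun v : X * Y => \int[m2]_y k v y))//.
- by apply: (measurable_fun_fubini_tonelli_F _ mk) => v; exact: h0.
- by move=> v; apply: integral_ge0 => y _; exact: h0.
Qed.

End tonelli_exchange.

Section cube_pairs.
Context {R : realType}.
Notation U := (@unit_interval_measure R : probability R R).
Notation C := (@cube_measure R).

Definition cons_pairs (d : nat) (u : (R * R) * (d.-tuple R * d.-tuple R)) :
    d.+1.-tuple R * d.+1.-tuple R :=
  (tuple_cons (u.1.1, u.2.1), tuple_cons (u.1.2, u.2.2)).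

Lemma measurable_cons_pairs (d : nat) : measurable_fun setT (@cons_pairs d).
Proof.
apply/measurable_fun_pairP; split => /=.
  apply: (measurableT_comp (@measurable_tuple_cons R d)).
  apply/measurable_fun_pairP; split.
    exact: (measurableT_comp measurable_fst measurable_fst).
  exact: (measurableT_comp measurable_fst measurable_snd).
apply: (measurableT_comp (@measurable_tuple_cons R d)).
apply/measurable_fun_pairP; split.
  exact: (measurableT_comp measurable_snd measurable_fst).
exact: (measurableT_comp measurable_snd measurable_snd).
Qed.

Local Open Scope ereal_scope.

Lemma integral_cubeS (d : nat) (h : d.+1.-tuple R -> \bar R) :
  measurable_fun setT h -> (forall x, 0 <= h x) ->
  \int[C d.+1]_x h x = \int[U]_s \int[C d]_x h (tuple_cons (s, x)).
Proof.
move=> mh h0.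
have mhc : measurable_fun setT (h \o @tuple_cons R d).
  by apply: measurableT_comp => //; exact: measurable_tuple_cons.
rewrite -(fubini_tonelli1 (h \o @tuple_cons R d))//; last by move=> z; exact: h0.
rewrite [LHS](ge0_integral_pushforward (@measurable_tuple_cons R d))//.
Qed.

Lemma integral_cube_pairsS (d : nat) (h : d.+1.-tuple R * d.+1.-tuple R -> \bar R) :
  measurable_fun setT h -> (forall z, 0 <= h z) ->
  \int[square_prob (C d.+1)]_z h z =
  \int[square_prob U \x square_prob (C d)]_u h (cons_pairs d u).
Proof.
move=> mh h0.
have mhc : measurable_fun setT (h \o @cons_pairs d).
  by apply: measurableT_comp => //; exact: measurable_cons_pairs.
have hc0 u : 0 <= (h \o @cons_pairs d) u by exact: h0.
rewrite (tonelli_exchange U (C d) (h \o @cons_pairs d) mhc hc0).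
rewrite /square_prob fubini_tonelli1//.
rewrite integral_cubeS; last 2 first.
- exact: measurable_fun_fubini_tonelli_F.
- by move=> x; exact: integral_ge0.
apply: eq_integral => s _; apply: eq_integral => x _.
rewrite /fubini_F integral_cubeS//.
by apply: (measurableT_comp mh); exact: pair1_measurable.
Qed.

Lemma ae_cube_pairsS (d : nat) (Q : set (d.+1.-tuple R * d.+1.-tuple R)) :
  measurable Q ->
  {ae square_prob U \x square_prob (C d), forall u, Q (cons_pairs d u)} ->
  {ae square_prob (C d.+1), forall z, Q z}.
Proof.
move=> mQ aeQ; apply/(ae_integral_indic0 _ _ mQ).
rewrite integral_cube_pairsS; last 2 first.
- by apply/measurable_EFinP/measurable_indic/measurableC.
- by move=> z; rewrite lee_fin.
have mQc : measurable [set u | Q (cons_pairs d u)].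
  by rewrite -[X in measurable X]setTI; exact: measurable_cons_pairs.
exact/(ae_integral_indic0 _ _ mQc).
Qed.

End cube_pairs.

(** * The inequality for rectangle differences *)

Section rectangular_grr.
Context {R : realType}.
Notation U := (@unit_interval_measure R : probability R R).
Notation C := (@cube_measure R).

Definition rect_weight (d : nat) (e : 'I_d -> R) (z : d.-tuple R * d.-tuple R) : R :=
  \prod_(k < d) `|tnth z.1 k - tnth z.2 k| `^ e k.

Lemma rect_weight_ge0 (d : nat) (e : 'I_d -> R) z : 0 <= rect_weight d e z.
Proof. by apply: prodr_ge0 => k _; exact: powR_ge0. Qed.

Lemma measurable_rect_weight (d : nat) (e : 'I_d -> R) :
  measurable_fun setT (rect_weight d e).
Proof.
apply: measurable_prod => k _.
apply: (measurableT_comp (measurable_powR _)); apply: measurableT_comp => //.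
by apply: measurable_funB; apply: (measurableT_comp (@measurable_tnth _ R d k)).
Qed.

Lemma rect_weight_cons (d : nat) (e : 'I_d.+1 -> R) u :
  rect_weight d.+1 e (cons_pairs d u) =
  `|u.1.1 - u.1.2| `^ e ord0 * rect_weight d (fun k => e (lift ord0 k)) u.2.
Proof.
rewrite /rect_weight big_ord_recl/= !tnth0; congr (_ * _).
by apply: eq_bigr => k _; rewrite !tnthS.
Qed.

Lemma measurable_powR_rect_diff (d : nat) (f : d.-tuple R -> R) (p : R) :
  measurable_fun setT f ->
  measurable_fun setT (fun z => (`|rect_diff f z.1 z.2| `^ p)%:E).
Proof.
move=> mf; apply/measurable_EFinP/(measurableT_comp (measurable_powR p)).
by apply: measurableT_comp => //; exact: measurable_rect_diff_det.
Qed.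

(** The induction splits the pairs of points of dimension d + 1 into the pair of
    their first coordinates, to which the one-dimensional inequality applies,
    and the pair of the remaining ones, to which the induction hypothesis does. *)
Lemma rect_grr_ae (d : nat) (f : d.-tuple R -> R) (alpha : 'I_d -> R) (p : R) :
  measurable_fun setT f -> 1 <= p -> (forall k, p^-1 < alpha k) ->
  {ae square_prob (C d), forall z, ((`|rect_diff f z.1 z.2| `^ p)%:E <=
    ((\prod_(k < d) grr_const (alpha k) p `^ p) *
       rect_weight d (fun k => (alpha k * p - 1)%R) z)%:E *
    \int[square_prob (C d)]_u ((`|rect_diff f u.1 u.2| `^ p)%:E *
      (rect_weight d (fun k => (- (alpha k * p + 1))%R) u)%:E))%E}.
Proof.
elim: d f alpha => [|d IH] f alpha mf p1 pa.
  apply: aeW => z.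
  have fE (u : 0.-tuple R * 0.-tuple R) :
      rect_diff f u.1 u.2 = rect_diff f z.1 z.2.
    by rewrite (tuple0 u.1) (tuple0 u.2) (tuple0 z.1) (tuple0 z.2).
  under eq_integral => u _ do rewrite fE /rect_weight big_ord0 mule1.
  rewrite integral_cst// [X in (_ * (_ * X))%E](_ : _ = 1%E) ?mule1; last first.
    exact: probability_setT.
  by rewrite /rect_weight !big_ord0 mulr1 mul1e.
have mF := measurable_powR_rect_diff d.+1 f p mf.
pose a (s : R * R) := `|s.1 - s.2| `^ (- (alpha ord0 * p + 1)).
pose A (s : R * R) := grr_const (alpha ord0) p `^ p *
  `|s.1 - s.2| `^ (alpha ord0 * p - 1).
pose b := rect_weight d (fun k => - (alpha (lift ord0 k) * p + 1)).
pose B z := (\prod_(k < d) grr_const (alpha (lift ord0 k)) p `^ p) *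
  rect_weight d (fun k => alpha (lift ord0 k) * p - 1) z.
have m_diff e : measurable_fun setT (fun s : R * R => `|s.1 - s.2| `^ e).
  apply: (measurableT_comp (measurable_powR _)); apply: measurableT_comp => //.
  exact: measurable_funB.
have const0 (c : R) : 0 <= grr_const c p `^ p by exact: powR_ge0.
pose F u := (`|rect_diff f (cons_pairs d u).1 (cons_pairs d u).2| `^ p)%:E.
have mFc : measurable_fun setT F.
  exact: (measurableT_comp mF (measurable_cons_pairs d)).
have F0 u : (0 <= F u)%E by rewrite lee_fin powR_ge0.
have mfc t : measurable_fun setT (fun x => f (tuple_cons (t, x))).
  apply: (measurableT_comp mf).
  exact: (measurableT_comp (@measurable_tuple_cons R d) (pair1_measurable t)).
have boundX z : {ae square_prob U, forall s, (F (s, z) <=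
    (A s)%:E * \int[square_prob U]_s' (F (s', z) * (a s')%:E))%E}.
  pose g t := rect_diff (fun x => f (tuple_cons (t, x))) z.1 z.2.
  have mg : measurable_fun setT g.
    apply: measurable_sum => S; apply: measurable_funM => //.
    apply: (measurableT_comp mf).
    exact: (measurableT_comp (@measurable_tuple_cons R d) (pair2_measurable _)).
  have FE s : F (s, z) = (`|g s.1 - g s.2| `^ p)%:E.
    by rewrite /F rect_diff_cons distrC.
  have := grr_ae g mg (alpha ord0) p p1 (pa ord0).
  apply: filterS => s; rewrite FE.
  by under [X in _ -> (_ <= _ * X)%E]eq_integral do rewrite FE.
have boundY s : {ae square_prob (C d), forall z, (F (s, z) <=
    (B z)%:E * \int[square_prob (C d)]_z' (F (s, z') * (b z')%:E))%E}.
  pose h x := f (tuple_cons (s.2, x)) - f (tuple_cons (s.1, x)).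
  have mh : measurable_fun setT h by exact: measurable_funB.
  have FE z : F (s, z) = (`|rect_diff h z.1 z.2| `^ p)%:E.
    by rewrite /F rect_diff_cons -rect_diffB.
  have := IH h (fun k => alpha (lift ord0 k)) mh p1 (fun k => pa (lift ord0 k)).
  apply: filterS => z; rewrite FE.
  by under [X in _ -> (_ <= _ * X)%E]eq_integral do rewrite FE.
set K := (\int[_]_u _)%E.
have KE : K = (\int[square_prob U \x square_prob (C d)]_u
    (F u * (a u.1 * b u.2)%:E))%E.
  rewrite /K integral_cube_pairsS.
  - by apply: eq_integral => u _; rewrite rect_weight_cons.
  - apply: emeasurable_funM => //; apply/measurable_EFinP.
    exact: measurable_rect_weight.
  - by move=> u; rewrite mule_ge0// lee_fin ?powR_ge0 ?rect_weight_ge0.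
apply: ae_cube_pairsS.
  rewrite -[X in measurable X]setTI; apply: measurable_lee => //.
  apply: emeasurable_funM => //; apply/measurable_EFinP.
  by apply: measurable_funM => //; exact: measurable_rect_weight.
have := ae_bound_tensor (square_prob U) (square_prob (C d)) F a A b B mFc F0.
rewrite -KE => tensor.
have {tensor} := tensor _ _ _ _ _ _ _ _ boundX boundY.
move=> /(_ (m_diff _) (fun=> powR_ge0 _ _) (measurable_rect_weight _ _)).
move=> /(_ (rect_weight_ge0 _ _) (measurable_funM (measurable_cst _) (m_diff _))).
move=> /(_ (fun=> mulr_ge0 (const0 _) (powR_ge0 _ _))).
move=> /(_ (measurable_funM (measurable_cst _) (measurable_rect_weight _ _))).
have B0 z : 0 <= B z.
  by rewrite mulr_ge0 ?rect_weight_ge0//; apply: prodr_ge0 => k _.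
move=> /(_ B0); apply: filterS => u.
by rewrite rect_weight_cons big_ord_recl mulrACA.
Qed.

End rectangular_grr.

(** * Dense sequences inside sets of full measure *)

Section cube_sets.
Context {R : realType}.
Notation U := (@unit_interval_measure R : probability R R).
Notation C := (@cube_measure R).

Definition box (d : nat) (J : 'I_d -> set R) : set (d.-tuple R) :=
  [set x | forall k, J k (tnth x k)].

Lemma measurable_box (d : nat) (J : 'I_d -> set R) :
  (forall k, measurable (J k)) -> measurable (box d J).
Proof.
move=> mJ; rewrite (_ : box d J = \bigcap_k [set x | J k (tnth x k)]); last first.
  by apply/seteqP; split => x Jx k; [move=> _|]; exact: Jx.
apply: fin_bigcap_measurable => [|k _]; first exact: finite_finset.
by rewrite -[X in measurable X]setTI; exact: (@measurable_tnth _ R d k).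
Qed.

Lemma cube_measure_boxS (d : nat) (J : 'I_d.+1 -> set R) :
  (forall k, measurable (J k)) ->
  C d.+1 (box d.+1 J) =
  (U (J ord0) * C d (box d (fun k => J (lift ord0 k))))%E.
Proof.
move=> mJ; rewrite /= /pushforward -product_measure1E//; last exact: measurable_box.
congr (_ _); apply/seteqP; split => [[s x]|[s x] [/= Js Jx]].
  move=> /= Jsx; split => /=; first by have := Jsx ord0; rewrite tnth0.
  by move=> k; have := Jsx (lift ord0 k); rewrite tnthS.
by move=> k; case: (unliftP ord0 k) => [j|] ->; rewrite ?tnthS ?tnth0//; exact: Jx.
Qed.

Lemma cube_measure_box_gt0 (d : nat) (J : 'I_d -> set R) :
  (forall k, measurable (J k)) -> (forall k, (0 < U (J k))%E) ->
  (0 < C d (box d J))%E.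
Proof.
elim: d J => [|d IH] J mJ J0.
  by rewrite /= diracE mem_set ?lte_fin ?ltr01// => -[].
rewrite cube_measure_boxS// mule_gt0//.
by apply: IH => k; [exact: mJ|exact: J0].
Qed.

Lemma unit_cube_box (d : nat) : @unit_cube R d = box d (fun=> `[0, 1]%classic).
Proof. by []. Qed.

Lemma measurable_unit_cube (d : nat) : measurable (@unit_cube R d).
Proof. by rewrite unit_cube_box; apply: measurable_box => k; exact: measurable_itv. Qed.

Lemma cube_measure_unit_cube (d : nat) : C d (@unit_cube R d) = 1%E.
Proof.
rewrite unit_cube_box; elim: d => [|d IH].
  by rewrite /= diracE mem_set// => -[].
rewrite cube_measure_boxS ?IH// mule1.
by transitivity ((1 - 0)%:E : \bar R);
  [exact: unit_interval_measure_itv|rewrite subr0].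
Qed.

Lemma ae_unit_cube (d : nat) : {ae C d, forall x, @unit_cube R d x}.
Proof.
apply/(negligibleP _ (measurableC (measurable_unit_cube d))).
have := probability_setC (C d) (measurable_unit_cube d).
by rewrite cube_measure_unit_cube subee.
Qed.

Lemma ae_unit_cube_pairs (d : nat) :
  {ae square_prob (C d), forall z, (@unit_cube R d `*` @unit_cube R d) z}.
Proof.
apply/(ae_prodP1 _ _ _ (measurableX (measurable_unit_cube d) (measurable_unit_cube d))).
have cubeT := ae_unit_cube d.
by apply: filterS (cubeT) => x x01; apply: filterS (cubeT) => y y01.
Qed.

Lemma integral_unit_cube (d : nat) (h : d.-tuple R -> \bar R) :
  measurable_fun setT h -> (forall x, (0 <= h x)%E) ->
  (\int[C d]_(x in @unit_cube R d) h x = \int[C d]_x h x)%E.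
Proof.
move=> mh h0; have mc := measurable_unit_cube d.
rewrite [RHS](ge0_negligible_integral (measurableC mc))//.
  by rewrite setDE setCK setTI.
apply/(negligibleP _ (measurableC mc)); exact: ae_unit_cube.
Qed.

Definition cell (u : R) (e : R) : set R := [set x | `|u - x| < e].

Lemma measurable_cell (u e : R) : measurable (cell u e).
Proof.
rewrite (_ : cell u e = `]u - e, u + e[%classic); first exact: measurable_itv.
apply/seteqP; split => x; rewrite /cell/= in_itv/= ltr_norml => /andP[? ?];
  by apply/andP; split; lra.
Qed.

Lemma unit_interval_measure_cell_gt0 (u e : R) :
  0 <= u <= 1 -> 0 < e -> (0 < U (cell u e))%E.
Proof.
move=> /andP[u0 u1] e0.
pose l := Num.max 0 (u - e / 2); pose r := Num.min 1 (u + e / 2).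
have lr : l < r by rewrite /l /r; case: (leP 0) => ?; case: (leP 1) => ?; lra.
apply: (@lt_le_trans _ _ (U `[l, r]%classic)).
  rewrite [ltRHS](_ : _ = (r - l)%:E) ?lte_fin ?subr_gt0//.
  apply: unit_interval_measure_itv; rewrite ?(ltW lr) ?/l ?/r ?le_max ?lexx//.
  by rewrite ge_min lexx.
apply: le_measure; rewrite ?inE; [exact: measurable_itv|exact: measurable_cell|].
move=> x; rewrite /cell/= in_itv/= => /andP[].
rewrite /l /r ge_max le_min => /andP[? ?] /andP[? ?].
by rewrite ltr_norml; apply/andP; split; lra.
Qed.

(** Each neighbourhood of a point of the cube meets the cube in a set of
    positive measure. *)
Lemma ae_unit_cube_close_pair (d : nat) (Z : set (d.-tuple R * d.-tuple R)) :
  {ae square_prob (C d), forall z, Z z} ->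
  forall u, (@unit_cube R d `*` @unit_cube R d) u -> forall e, 0 < e ->
  exists2 v, Z v & close_pair e u v.
Proof.
move=> aeZ [x y] [/= x01 y01] e e0; apply: contrapT => noZ.
pose J z := box d (fun k => cell (tnth z k) e).
have mJ z : measurable (J z) by apply: measurable_box => k; exact: measurable_cell.
have J0 z : @unit_cube R d z -> (0 < C d (J z))%E.
  move=> z01; apply: cube_measure_box_gt0 => k; first exact: measurable_cell.
  by apply: unit_interval_measure_cell_gt0 => //; exact: z01.
have : (0 < square_prob (C d) (J x `*` J y))%E.
  by rewrite /square_prob [ltRHS]product_measure1E// mule_gt0 ?J0.
suff -> : square_prob (C d) (J x `*` J y) = 0%E by rewrite ltxx.
apply/(negligibleP _ (measurableX (mJ x) (mJ y))).
apply: negligibleS aeZ => v [/= Jx Jy] Zv; apply: noZ; exists v => // k.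
by split; [exact: Jx|exact: Jy].
Qed.

Lemma rat_tuple_close (d : nat) (x : d.-tuple R) (e : R) : 0 < e ->
  exists q : d.-tuple rat, forall k, `|tnth x k - ratr (tnth q k)| < e.
Proof.
move=> e0.
have /choice[q xq] : forall k, exists q : rat, `|tnth x k - ratr q| < e.
  move=> k; have [|q] := @rat_in_itvoo R (tnth x k - e) (tnth x k + e).
    by rewrite ltrBlDr -addrA ltrDl addr_gt0.
  rewrite in_itv/= => /andP[? ?]; exists q.
  by rewrite ltr_norml; apply/andP; split; lra.
by exists [tuple q k | k < d] => k; rewrite tnth_mktuple.
Qed.

(** For each rational ball that meets Z inside the cube, a point of the
    intersection is picked; [hP] below falls back on an arbitrary point of Z for
    the other balls, so that the sequence is total. *)
Lemma exists_dense_sequence (d : nat) (Z : set (d.-tuple R * d.-tuple R)) :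
  {ae square_prob (C d), forall z, Z z} ->
  exists v : nat -> d.-tuple R * d.-tuple R,
    (forall n, Z (v n)) /\ countable_dense_pairs (range v).
Proof.
move=> aeZ.
have {aeZ} : {ae square_prob (C d), forall z,
    Z z /\ (@unit_cube R d `*` @unit_cube R d) z}.
  by apply: filterS2 aeZ (ae_unit_cube_pairs d) => z.
set Z' := (X in {ae _, forall z, X z}) => aeZ.
have close_Z := ae_unit_cube_close_pair d Z' aeZ.
pose I := (nat * (d.-tuple rat * d.-tuple rat))%type.
pose ratpair (q : d.-tuple rat * d.-tuple rat) : d.-tuple R * d.-tuple R :=
  ([tuple ratr (tnth q.1 k) | k < d], [tuple ratr (tnth q.2 k) | k < d]).
have [z0 Z'0 _] : exists2 v, Z' v &
    close_pair 1 ([tuple 0 : R | _ < d], [tuple 0 : R | _ < d]) v.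
  by apply: close_Z => //; split => k; rewrite /= tnth_mktuple lexx ler01.
have /choice[h hP] : forall i : I, exists v, Z' v /\
    ((exists2 v, Z' v & close_pair i.1.+1%:R^-1 (ratpair i.2) v) ->
     close_pair i.1.+1%:R^-1 (ratpair i.2) v).
  move=> i; have [[v Zv cv]|nov] :=
    pselect (exists2 v, Z' v & close_pair i.1.+1%:R^-1 (ratpair i.2) v).
    by exists v.
  by exists z0.
pose i0 : I := (0%N, ([tuple 0 | _ < d], [tuple 0 | _ < d])).
exists (fun n => h (odflt i0 (unpickle n))).
split; first by move=> n; have [[]] := hP (odflt i0 (unpickle n)).
split.
- exact: card_image_le.
- by move=> _ [n _ <-]; have [[]] := hP (odflt i0 (unpickle n)).
move=> u u01 e e0.
pose n := Num.trunc (2 / e).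
have n_lt : n.+1%:R^-1 < e / 2.
  rewrite -[ltRHS]invrK ltf_pV2 ?posrE ?invr_gt0 ?divr_gt0//.
  by rewrite invf_div truncnS_gt.
set m := n.+1%:R^-1 in n_lt.
have m0 : 0 < m by rewrite invr_gt0.
have [|q1 uq1] := @rat_tuple_close d u.1 (m / 2); first by rewrite divr_gt0.
have [|q2 uq2] := @rat_tuple_close d u.2 (m / 2); first by rewrite divr_gt0.
have [_ ] := hP (n, (q1, q2)).
set v := h _ => vP.
exists v; first by exists (pickle ((n, (q1, q2)) : I)) => //; rewrite pickleK.
have {}vP : close_pair m (ratpair (q1, q2)) v.
  apply: vP => /=.
  have [|w Zw uw] := close_Z u u01 (m / 2); first by rewrite divr_gt0.
  exists w => // k; have [uw1 uw2] := uw k.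
  have := uq1 k; have := uq2 k; rewrite /ratpair/= !tnth_mktuple -/m.
  move: uw1 uw2; rewrite !ltr_norml => /andP[? ?] /andP[? ?] /andP[? ?] /andP[? ?].
  by split; apply/andP; split; lra.
move=> k; have := vP k; have := uq1 k; have := uq2 k.
rewrite /ratpair/= !tnth_mktuple !ltr_norml.
move=> /andP[? ?] /andP[? ?] [/andP[? ?] /andP[? ?]].
by split; apply/andP; split; lra.
Qed.

End cube_sets.

(** * From a dense set of rectangles to all rectangles *)

Section separable_extension.
Context {R : realType} (d : nat).
Implicit Types (f : d.-tuple R -> R) (x y : d.-tuple R).

Lemma rect_diff_dist f x y x' y' (e : R) :
  (forall S, `|f (corner x y S) - f (corner x' y' S)| <= e) ->
  `|rect_diff f x y - rect_diff f x' y'| <= #|{set 'I_d}|%:R * e.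
Proof.
move=> fe; rewrite /rect_diff -sumrB.
apply: le_trans (ler_norm_sum _ _ _) _.
rewrite mulr_natl -sumr_const; apply: ler_sum => S _.
by rewrite -mulrBr normrM normrX normrN1 expr1n mul1r.
Qed.

(** The exponential makes these bounds multiply over the coordinates into a
    continuous function of e. *)
Lemma powR_addl_le (delta b e : R) : 0 < delta -> 0 < b -> 0 <= e ->
  (delta + e) `^ b <= delta `^ b * expR (b / delta * e).
Proof.
move=> delta0 b0 e0.
have -> : b / delta * e = (e / delta) * b by rewrite mulrC mulrCA mulrC.
rewrite expRM -powRM ?expR_ge0 ?(ltW delta0)//.
apply: ge0_ler_powR; rewrite ?nnegrE ?(ltW b0) ?addr_ge0 ?(ltW delta0)//.
  by rewrite mulr_ge0 ?expR_ge0 ?(ltW delta0).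
rewrite (_ : delta + e = delta * (1 + e / delta)).
  by rewrite ler_pM2l// expR_ge1Dx.
by field; rewrite gt_eqF.
Qed.

(** A rectangle with sides at most delta k is within e of rectangles of D, whose
    sides are at most delta k + 2 e; then e tends to 0. *)
Lemma rect_diff_le_of_dense f (D : set (d.-tuple R * d.-tuple R))
    (K : R) (b delta : 'I_d -> R) :
  0 <= K -> (forall k, 0 < b k) -> (forall k, 0 < delta k) ->
  (forall v, D v -> `|rect_diff f v.1 v.2| <= K * rect_weight d b v) ->
  (forall u, (@unit_cube R d `*` @unit_cube R d) u -> forall e, 0 < e ->
    exists v, [/\ D v, close_pair e u v &
      forall S, `|f (corner u.1 u.2 S) - f (corner v.1 v.2 S)| < e]) ->
  forall u, (@unit_cube R d `*` @unit_cube R d) u ->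
    (forall k, `|tnth u.1 k - tnth u.2 k| <= delta k) ->
    `|rect_diff f u.1 u.2| <= K * \prod_(k < d) delta k `^ b k.
Proof.
move=> K0 b0 delta0 fD fsep u u01 u_delta.
set M := \prod_(k < d) _.
pose N : R := #|{set 'I_d}|%:R.
pose c := \sum_(k < d) b k / delta k * 2.
have le_e e : 0 < e -> `|rect_diff f u.1 u.2| <= K * (M * expR (c * e)) + N * e.
  move=> e0; have [v [Dv uv fuv]] := fsep u u01 e e0.
  have -> : rect_diff f u.1 u.2 = rect_diff f v.1 v.2 +
      (rect_diff f u.1 u.2 - rect_diff f v.1 v.2) by rewrite addrC subrK.
  apply: le_trans (ler_normD _ _) _; apply: lerD; last first.
    by apply: rect_diff_dist => S; exact: ltW.
  apply: le_trans (fD v Dv) _; apply: ler_wpM2l => //.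
  rewrite /c mulr_suml expR_sum -big_split/=.
  apply: ler_prod => k _; rewrite powR_ge0/= -mulrA.
  apply: le_trans (@powR_addl_le _ _ (2 * e) (delta0 k) (b0 k) _); last first.
    by rewrite mulr_ge0// ltW.
  apply: ge0_ler_powR; rewrite ?nnegrE ?(ltW (b0 k)) ?addr_ge0 ?mulr_ge0//.
  - exact: ltW.
  - exact: ltW.
  have [] := uv k; have := u_delta k; rewrite !ler_norml !ltr_norml.
  by move=> /andP[? ?] /andP[? ?] /andP[? ?]; apply/andP; split; lra.
have cv : (K * (M * expR (c * e)) + N * e @[e --> 0^'+] -->
    K * (M * expR (c * 0)) + N * 0)%classic.
  apply: cvg_at_right_filter; apply: cvgD.
    apply: cvgMr; apply: cvgMr.
    apply: (@continuous_comp _ _ _ ( *%R c) expR); last exact: continuous_expR.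
    exact: mulrl_continuous.
  exact: mulrl_continuous.
rewrite !mulr0 expR0 mulr1 addr0 in cv.
apply: (cvgr_to_ge cv); near=> e; apply: le_e.
by near: e; exact: nbhs_right_gt.
Unshelve. all: by end_near. Qed.

End separable_extension.

(** * Norms of functions dominated by a measurable one *)

(** Young's inequality for the exponent p / A and the factors (h / c)^A and 1. *)
Lemma powR_young {R : realType} (A p c h : R) : 0 < A -> A < p -> 0 < c -> 0 <= h ->
  (h `^ A <= c `^ A * (A / p * (h `^ p / c `^ p) + (1 - A / p))).
Proof.
move=> A0 Ap c0 h0; have p0 := lt_trans A0 Ap.
pose x := (h / c).
have x0 : (0 <= x) by rewrite divr_ge0// ltW.
have -> : (h `^ A = c `^ A * x `^ A).
  rewrite -powRM ?(ltW c0)// /x; congr (_ `^ _).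
  by rewrite mulrC divfK// gt_eqF.
apply: ler_wpM2l; first exact: powR_ge0.
have Ap0 : (0 < 1 - A / p) by rewrite subr_gt0 ltr_pdivrMr// mul1r.
have := @conjugate_powR R (x `^ A) 1 (p / A) (1 - A / p)^-1.
rewrite powR_ge0 ler01 divr_gt0// invr_gt0 Ap0 => /(_ isT isT isT isT).
rewrite invrK invf_div addrC subrK => /(_ erefl).
rewrite mulr1 powR1 mul1r -powRrM.
rewrite (_ : A * (p / A) = p); last by field; rewrite gt_eqF.
have <- : x `^ p = h `^ p / c `^ p.
  rewrite /x powRM ?invr_ge0 ?(ltW c0)// -powR_inv1 ?(ltW c0)// -powRrM.
  by rewrite mulN1r powRN.
by rewrite [_ * (A / p)]mulrC.
Qed.

Section Lnorm_domination.
Context {disp : measure_display} {T : measurableType disp} {R : realType}.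
Context (P : probability T R).
Local Open Scope ereal_scope.

(** The integral of a nonnegative function is the supremum of the integrals of
    the simple functions below it, hence is monotone even without
    measurability.  This matters for the modulus, a supremum over uncountably
    many rectangles. *)
Lemma ge0_le_integral_majorant (f g : T -> \bar R) :
  (forall x, 0 <= f x) -> (forall x, f x <= g x) ->
  \int[P]_x f x <= \int[P]_x g x.
Proof.
move=> f0 fg; have g0 x : 0 <= g x by exact: le_trans (fg x).
rewrite !ge0_integralTE//; apply: le_ereal_sup => _ [h hf <-].
by exists h => //= x; exact: le_trans (fg x).
Qed.

(** Making g infinite on the exceptional null set does not change its
    integral. *)
Lemma ae_ge0_le_integral_majorant (f g : T -> \bar R) :
  (forall x, 0 <= f x) -> (forall x, 0 <= g x) -> measurable_fun setT g ->
  {ae P, forall x, f x <= g x} -> \int[P]_x f x <= \int[P]_x g x.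
Proof.
move=> f0 g0 mg [N [mN PN0 fgN]].
pose g' x := g x + +oo * (\1_N x)%:E.
have mi : measurable_fun setT (fun x => +oo * (\1_N x : R)%:E).
  by apply: emeasurable_funM => //; apply/measurable_EFinP; exact: measurable_indic.
have mg' : measurable_fun setT g' by exact: emeasurable_funD.
have i0 x : 0 <= +oo * (\1_N x : R)%:E by rewrite mule_ge0// ?leey// lee_fin.
have g'0 x : 0 <= g' x by rewrite adde_ge0.
have -> : \int[P]_x g x = \int[P]_x g' x.
  apply: ge0_ae_eq_integral => //.
  exists N; split => // x /= gg'; apply: contrapT => Nx; apply: gg' => _.
  by rewrite /g' indicE memNset// mule0 adde0.
apply: ge0_le_integral_majorant => // x; rewrite /g' indicE.
have [xN|xN] := boolP (x \in N).
  by rewrite mule1 addey ?leey//; apply: contraTneq (g0 x) => ->.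
rewrite mule0 adde0; apply: contrapT => fgx.
by move/negP: xN; apply; rewrite inE; exact: fgN.
Qed.

(** For c larger than the norm M of H in L^p, [powR_young] integrates to
    E H^A <= c^A (A / p * M^p / c^p + 1 - A / p) <= c^A. *)
Lemma Lnorm_le_Lnorm_majorant (f H : T -> \bar R) (A p : R) :
  (0 < A)%R -> (A < p)%R ->
  measurable_fun setT H -> (forall x, 0 <= H x) ->
  {ae P, forall x, `|f x| <= H x} ->
  'N[P]_(A%:E)[f] <= 'N[P]_(p%:E)[H].
Proof.
move=> A0 Ap mH H0 fH; have p0 := lt_trans A0 Ap.
apply: (@le_trans _ _ ((\int[P]_x H x `^ A) `^ A^-1)).
  rewrite unlock; apply: gt0_ler_poweR; rewrite ?invr_ge0 ?(ltW A0)//.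
  - by rewrite in_itv/= leey andbT; apply: integral_ge0 => x _; exact: poweR_ge0.
  - by rewrite in_itv/= leey andbT; apply: integral_ge0 => x _; exact: poweR_ge0.
  apply: ae_ge0_le_integral_majorant.
  - by move=> x; exact: poweR_ge0.
  - by move=> x; exact: poweR_ge0.
  - exact: (measurableT_comp (measurable_poweR A)).
  apply: filterS fH => x fHx; apply: gt0_ler_poweR; rewrite ?(ltW A0)//.
  - by rewrite in_itv/= leey andbT.
  - by rewrite in_itv/= leey andbT.
set M := 'N[P]_(p%:E)[H].
have M0 : 0 <= M by exact: Lnorm_ge0.
have ME : \int[P]_x H x `^ p = M `^ p.
  rewrite /M poweR_Lnorm ?gt_eqF//.
  by apply: eq_integral => x _; rewrite gee0_abs.
have [->|] := eqVneq M +oo; first by rewrite leey.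
rewrite -ltey => Mfin.
have MR : M = (fine M)%:E by rewrite fineK// ge0_fin_numE.
have M0' : (0 <= fine M)%R by exact: fine_ge0.
rewrite MR; apply/lee_addgt0Pr => e e0; rewrite -EFinD.
set c := (fine M + e)%R.
have c0 : (0 < c)%R by rewrite ltr_wpDl.
have le_c : \int[P]_x H x `^ A <= (c `^ A)%:E.
  have r0 : (0 <= 1 - A / p)%R by rewrite subr_ge0 ler_pdivrMr// mul1r ltW.
  have k0 : (0 <= A / p / c `^ p)%R.
    by rewrite divr_ge0 ?powR_ge0// divr_ge0 ?ltW.
  pose G x := (c `^ A)%:E * ((A / p / c `^ p)%:E * H x `^ p + (1 - A / p)%:E).
  have HG x : H x `^ A <= G x.
    move: (H0 x); rewrite /G; case: (H x) => [h|_|//].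
    - rewrite lee_fin => h0; rewrite !poweR_EFin -!EFinM lee_fin.
      rewrite (_ : A / p / c `^ p * h `^ p = A / p * (h `^ p / c `^ p))%R.
        exact: powR_young.
      by rewrite mulrAC -mulrA.
    - rewrite !poweRyr ?gt_eqF// gt0_muley ?lte_fin ?divr_gt0 ?powR_gt0//.
      by rewrite addye// gt0_muley ?lte_fin ?powR_gt0.
  have mHp : measurable_fun setT (fun x => H x `^ p).
    exact: (measurableT_comp (measurable_poweR p)).
  have Hp0 x : 0 <= H x `^ p by exact: poweR_ge0.
  apply: (@le_trans _ _ (\int[P]_x G x)).
    by apply: ge0_le_integral_majorant => // x; exact: poweR_ge0.
  rewrite /G ge0_integralZl_EFin ?powR_ge0//; last 2 first.
  - by move=> x _; rewrite adde_ge0// ?lee_fin// mule_ge0// lee_fin.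
  - by apply: emeasurable_funD => //; exact: emeasurable_funM.
  rewrite ge0_integralD//; last 2 first.
  - by move=> x _; rewrite mule_ge0// lee_fin.
  - exact: emeasurable_funM.
  rewrite ge0_integralZl_EFin// ME integral_cst//.
  rewrite [X in _ + _ * X](_ : _ = 1) ?mule1; last exact: probability_setT.
  rewrite MR poweR_EFin -!EFinM lee_fin.
  rewrite ler_piMr ?powR_ge0//.
  apply: (@le_trans _ _ (A / p + (1 - A / p))%R); last by rewrite addrC subrK.
  apply: lerD => //.
  rewrite (_ : A / p / c `^ p * fine M `^ p = A / p * (fine M `^ p / c `^ p))%R;
    last by rewrite mulrAC -mulrA.
  apply: ler_piMr; first by rewrite divr_ge0 ?ltW.
  rewrite ler_pdivrMr ?powR_gt0// mul1r.
  by apply: ge0_ler_powR; rewrite ?nnegrE ?(ltW p0) ?(ltW c0)// /c lerDl ltW.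
apply: (@le_trans _ _ ((c `^ A)%:E `^ A^-1)).
  apply: gt0_ler_poweR => //; rewrite ?invr_ge0 ?(ltW A0)//.
  - by rewrite in_itv/= leey andbT; apply: integral_ge0 => x _; exact: poweR_ge0.
  - by rewrite in_itv/= leey andbT lee_fin powR_ge0.
by rewrite poweR_EFin -powRrM mulfV ?gt_eqF// powRr1// ltW.
Qed.

End Lnorm_domination.

(** * The moments of the rectangle modulus *)

Section modulus_moment.
Context {R : realType} {disp : measure_display} {T : measurableType disp}.
Context (P : probability T R) (d : nat) (xi : d.-tuple R -> T -> R).
Context (xi_measurable : measurable_field xi).
Context (alpha : 'I_d -> R) (p : R).
Notation C := (@cube_measure R).
Notation cube := (@unit_cube R d).

(** Extending by a constant makes the field measurable on the whole space, as
    Tonelli's theorem requires, and keeps the rectangle differences inside the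
    cube. *)
Definition cube_field : d.-tuple R * T -> R :=
  (fun z => xi z.1 z.2) \_ (cube `*` [set: T]).

Lemma measurable_cube_field : measurable_fun setT cube_field.
Proof.
apply/(measurable_restrictT _ _).1 => //.
exact: measurableX (measurable_unit_cube d) measurableT.
Qed.

Lemma unit_cube_corner (x y : d.-tuple R) (S : {set 'I_d}) :
  cube x -> cube y -> cube (corner x y S).
Proof. by move=> x01 y01 k; rewrite tnth_mktuple; case: ifP. Qed.

Lemma rect_diff_cube_field (x y : d.-tuple R) (w : T) : cube x -> cube y ->
  rect_diff (fun x' => cube_field (x', w)) x y = rect_diff (xi^~ w) x y.
Proof.
move=> x01 y01; apply: eq_bigr => S _; congr (_ * _).
rewrite /cube_field patchE mem_set//=; split => //.
exact: unit_cube_corner.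
Qed.

Definition grr_integrand (u : (d.-tuple R * d.-tuple R) * T) : \bar R :=
  ((`|rect_diff (fun x => cube_field (x, u.2)) u.1.1 u.1.2| `^ p)%:E *
   (rect_weight d (fun k => - (alpha k * p + 1)) u.1)%:E)%E.

Definition grr_energy (w : T) : \bar R :=
  (\int[square_prob (C d)]_z grr_integrand (z, w))%E.

Let grr_integrand_ge0 u : (0 <= grr_integrand u)%E.
Proof. by rewrite mule_ge0// lee_fin ?powR_ge0 ?rect_weight_ge0. Qed.

Let measurable_rect_diff_pow : measurable_fun setT
  (fun u : (d.-tuple R * d.-tuple R) * T =>
    (`|rect_diff (fun x => cube_field (x, u.2)) u.1.1 u.1.2| `^ p)%:E).
Proof.
apply/measurable_EFinP/(measurableT_comp (measurable_powR p)).
apply: measurableT_comp => //.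
exact: (measurable_rect_diff d cube_field measurable_cube_field).
Qed.

Let measurable_grr_integrand : measurable_fun setT grr_integrand.
Proof.
apply: emeasurable_funM => //.
apply/measurable_EFinP; apply: measurableT_comp => //.
exact: measurable_rect_weight.
Qed.

Lemma measurable_grr_energy : measurable_fun setT grr_energy.
Proof. exact: (measurable_fun_fubini_tonelli_G _ measurable_grr_integrand). Qed.

Lemma grr_energy_ge0 w : (0 <= grr_energy w)%E.
Proof. by apply: integral_ge0 => z _. Qed.

(** Tonelli's theorem, after which all the integrals can be restricted to the
    cube, a set of full measure. *)
Lemma theta_integralE :
  (\int[C d]_(x in cube) \int[C d]_(y in cube)
    ('E_P[fun w => (`|rect_diff (xi^~ w) x y| `^ p)%R] *
     ((\prod_(k < d) `|tnth x k - tnth y k| `^ (alpha k * p + 1))^-1)%:E) =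
   \int[P]_w grr_energy w)%E.
Proof.
pose V z := (\int[P]_w grr_integrand (z, w))%E.
have mV : measurable_fun setT V.
  exact: (measurable_fun_fubini_tonelli_F _ measurable_grr_integrand).
have V0 z : (0 <= V z)%E by apply: integral_ge0.
have -> : (\int[P]_w grr_energy w = \int[square_prob (C d)]_z V z)%E.
  by rewrite /grr_energy /V (fubini_tonelli grr_integrand).
have -> : (\int[square_prob (C d)]_z V z = \int[C d]_x \int[C d]_y V (x, y))%E.
  by rewrite /square_prob fubini_tonelli1.
rewrite -integral_unit_cube; last 2 first.
- exact: (measurable_fun_fubini_tonelli_F _ mV).
- by move=> x; exact: integral_ge0.
apply: eq_integral => x /set_mem x01; rewrite -integral_unit_cube; last 2 first.
- exact: (measurableT_comp mV (pair1_measurable x)).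
- by [].
apply: eq_integral => y /set_mem y01; rewrite /V /grr_integrand/=.
rewrite ge0_integralZr//; last 2 first.
- exact: (measurableT_comp measurable_rect_diff_pow (pair1_measurable (x, y))).
- by rewrite lee_fin rect_weight_ge0.
congr (_ * _)%E.
  rewrite unlock; apply: eq_integral => w _ /=.
  by rewrite rect_diff_cube_field.
congr (_%:E); rewrite /rect_weight -prodfV; apply: eq_bigr => k _.
by rewrite powRN.
Qed.

Lemma thetaE : theta P xi alpha p =
  ((\prod_(k < d) grr_const (alpha k) p)%:E * (\int[P]_w grr_energy w) `^ p^-1)%E.
Proof.
rewrite /theta theta_integralE; congr (_%:E * _)%E.
rewrite /grr_const [RHS]big_split/= prodr_const card_ord exprMn; congr (_ * _ * _).
by rewrite mulrC powRrM powR_mulrn// powR_ge0.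
Qed.

Lemma powR_prod (x : 'I_d -> R) (r : R) : (forall k, 0 <= x k) ->
  (\prod_(k < d) x k) `^ r = \prod_(k < d) x k `^ r.
Proof.
move=> x0; suff [] : 0 <= \prod_(k < d) x k /\
    (\prod_(k < d) x k) `^ r = \prod_(k < d) x k `^ r by [].
apply: (big_ind2 (fun u v => 0 <= u /\ u `^ r = v)).
- by rewrite powR1.
- move=> u1 v1 u2 v2 [u10 <-] [u20 <-]; split; first exact: mulr_ge0.
  exact: powRM.
- by [].
Qed.

Context (xi_separable : separable_field P xi).
Context (p1 : 1 <= p) (pa : forall k, p^-1 < alpha k).
Context (delta : 'I_d -> R) (delta_gt0 : forall k, 0 < delta k).

Let p0 : 0 < p. Proof. exact: lt_le_trans p1. Qed.

Definition modulus_majorant (w : T) : \bar R :=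
  ((\prod_(k < d) grr_const (alpha k) p * \prod_(k < d) delta k `^ (alpha k - p^-1))%:E
    * grr_energy w `^ p^-1)%E.

Let grr_prod_gt0 : 0 < \prod_(k < d) grr_const (alpha k) p.
Proof. by apply: prodr_gt0 => k _; apply: grr_const_gt0. Qed.

Let delta_prod_gt0 : 0 < \prod_(k < d) delta k `^ (alpha k - p^-1).
Proof. by apply: prodr_gt0 => k _; exact: powR_gt0. Qed.

(** For each w the path bound holds for almost every pair z, hence for almost
    every z it holds for almost every w.  A dense sequence of such pairs is a
    countable set, thus for almost every w the bound holds on all of it. *)
Lemma ae_rect_modulus_le_majorant :
  {ae P, forall w, (rect_modulus xi delta w <= modulus_majorant w)%E}.
Proof.
pose c := \prod_(k < d) grr_const (alpha k) p `^ p.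
pose e k := alpha k * p - 1.
pose Q := [set u : (d.-tuple R * d.-tuple R) * T |
  ((`|rect_diff (fun x => cube_field (x, u.2)) u.1.1 u.1.2| `^ p)%:E <=
   (c * rect_weight d e u.1)%:E * grr_energy u.2)%E].
have mQ : measurable Q.
  rewrite -[X in measurable X]setTI; apply: measurable_lee => //.
  apply: emeasurable_funM; last first.
    by apply: (measurableT_comp measurable_grr_energy).
  apply/measurable_EFinP; apply: measurable_funM => //.
  by apply: (measurableT_comp (measurable_rect_weight d e)).
have aeQ : {ae P, forall w, {ae square_prob (C d), forall z, Q (z, w)}}.
  apply: aeW => w.
  have mw : measurable_fun setT (fun x => cube_field (x, w)).
    exact: (measurableT_comp measurable_cube_field (pair2_measurable w)).
  exact: (rect_grr_ae d _ alpha p mw p1 pa).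
have [v [Qv vD]] := exists_dense_sequence d _
  ((ae_prodP1 _ _ _ mQ).1 ((ae_prodP2 _ _ _ mQ).2 aeQ)).
have cube_v n : cube (v n).1 /\ cube (v n).2.
  by have [_ vcube _] := vD; apply: (vcube (v n)); exists n.
apply: filterS2 (ae_foralln Qv) (xi_separable _ vD) => w Qw sepw.
rewrite /modulus_majorant.
have [->|] := eqVneq (grr_energy w) +oo%E.
  rewrite poweRyr ?invr_eq0 ?gt_eqF// gt0_muley ?leey// lte_fin.
  exact: mulr_gt0.
rewrite -ltey => Gfin.
have := grr_energy_ge0 w.
have {Gfin} : (grr_energy w < +oo)%E := Gfin.
have := Qw; rewrite /Q/=; case: (grr_energy w) => [G|//|//] {}Qw _.
rewrite lee_fin => G0.
apply: ge_ereal_sup => _ [u [u1 u2 udelta] <-].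
rewrite poweR_EFin -EFinM lee_fin mulrAC.
apply: (rect_diff_le_of_dense d (xi^~ w) (range v)).
- by rewrite mulr_ge0 ?powR_ge0// ltW.
- by move=> k; rewrite subr_gt0.
- by [].
- move=> _ [n _ <-]; have := Qw n; have [v1 v2] := cube_v n.
  rewrite rect_diff_cube_field// -EFinM lee_fin => Qn.
  rewrite -[leLHS](@powRr1 R)// -[X in _ `^ X <= _](mulfV (lt0r_neq0 p0)) powRrM.
  have c0 : 0 <= c by apply: prodr_ge0 => k _; exact: powR_ge0.
  have -> : \prod_(k < d) grr_const (alpha k) p * G `^ p^-1 *
      rect_weight d (fun k => alpha k - p^-1) (v n) =
      (c * rect_weight d e (v n) * G) `^ p^-1.
    rewrite powRM ?mulr_ge0 ?rect_weight_ge0//.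
    rewrite powRM ?rect_weight_ge0//.
    rewrite [RHS]mulrAC; congr (_ * _ * _).
      rewrite /c powR_prod; last by move=> k; exact: powR_ge0.
      apply: eq_bigr => k _; rewrite -powRrM mulfV ?gt_eqF// powRr1//.
      by apply: ltW; apply: grr_const_gt0.
    rewrite /rect_weight powR_prod; last by move=> k; exact: powR_ge0.
    apply: eq_bigr => k _; rewrite -powRrM /e mulrBl mul1r mulfK//.
    by rewrite gt_eqF.
  apply: ge0_ler_powR => //; rewrite ?nnegrE ?powR_ge0 ?invr_ge0 ?(ltW p0)//.
  by rewrite !mulr_ge0 ?rect_weight_ge0.
- exact: sepw.
- by split.
- exact: udelta.
Qed.

Lemma modulus_majorant_ge0 w : (0 <= modulus_majorant w)%E.
Proof.
rewrite mule_ge0 ?poweR_ge0// lee_fin; apply: ltW; exact: mulr_gt0.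
Qed.

Lemma measurable_modulus_majorant : measurable_fun setT modulus_majorant.
Proof.
apply: emeasurable_funM => //.
exact: (measurableT_comp (measurable_poweR _) measurable_grr_energy).
Qed.

Lemma Lnorm_modulus_majorant :
  ('N[P]_(p%:E)[modulus_majorant] =
    (\prod_(k < d) delta k `^ (alpha k - p^-1))%:E * theta P xi alpha p)%E.
Proof.
rewrite thetaE muleA -EFinM [X in (X%:E * _)%E]mulrC unlock.
set K := (_ * _)%R; have K0 : 0 <= K by apply: ltW; exact: mulr_gt0.
transitivity ((\int[P]_w ((K `^ p)%:E * grr_energy w)) `^ p^-1)%E.
  congr (_ `^ _)%E; apply: eq_integral => w _.
  rewrite gee0_abs ?modulus_majorant_ge0// /modulus_majorant.
  rewrite poweRM ?lee_fin ?poweR_ge0// poweR_EFin -poweRrM mulVf ?gt_eqF//.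
  by rewrite poweRe1// grr_energy_ge0.
rewrite ge0_integralZl_EFin ?powR_ge0//; last 2 first.
- by move=> w _; exact: grr_energy_ge0.
- exact: measurable_grr_energy.
rewrite poweRM ?lee_fin ?powR_ge0//; last first.
  by apply: integral_ge0 => w _; exact: grr_energy_ge0.
by rewrite poweR_EFin -powRrM mulfV ?gt_eqF// powRr1.
Qed.

End modulus_moment.

(** * Optimising over the exponent *)

Section fundamental_function_bound.
Context {R : realType}.

(** For t = D^(1/p) / psi p the hypothesis is N * t <= K, and the supremum of
    these t is the fundamental function.  It is finite unless N = 0. *)
Lemma le_div_fundamental_function (psi : R -> \bar R) (N : \bar R) (K D : R) :
  0 < K -> 0 < D -> (0 <= N)%E -> supp psi !=set0 ->
  (forall p, supp psi p -> (0 < psi p)%E) ->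
  (forall p, supp psi p -> (N <= (K / D `^ p^-1)%:E * psi p)%E) ->
  (N <= K%:E / fundamental_function psi D)%E.
Proof.
move=> K0 D0 N0 [p0 psi_p0] psi_gt0 N_le.
pose t p := ((D `^ p^-1)%:E / psi p)%E.
have t_gt0 p : supp psi p -> (0 < t p)%E.
  move=> psi_p; rewrite mule_gt0 ?lte_fin ?powR_gt0//.
  have psi0 := psi_gt0 p psi_p; have psioo : (psi p < +oo)%E by [].
  have psi_neq0 : psi p != 0%E by rewrite gt_eqF.
  have psi_neqoo : psi p != +oo%E by rewrite lt_eqF.
  by rewrite inve_gt0.
have phi_ge p : supp psi p -> (t p <= fundamental_function psi D)%E.
  by move=> psi_p; apply: ereal_sup_ubound; exists p.
have phi_gt0 := lt_le_trans (t_gt0 _ psi_p0) (phi_ge _ psi_p0).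
have [<-|N_neq0] := eqVneq 0%E N.
  by rewrite mule_ge0 ?lee_fin ?(ltW K0)// inve_ge0 ltW.
have psiE p : supp psi p -> exists2 s, psi p = s%:E & 0 < s.
  move=> psi_p; have := psi_gt0 _ psi_p; move: psi_p; rewrite /supp/=.
  by case: (psi p) => [s _ s0|//|//]; exists s.
have Nfin : (N < +oo)%E.
  apply: le_lt_trans (N_le _ psi_p0) _.
  by have [s -> s0] := psiE _ psi_p0; rewrite -EFinM ltey.
move: N0 N_neq0 N_le Nfin; case: N => [n|//|//] n0 n_neq0 N_le _.
have {n0 n_neq0} n0 : 0 < n by rewrite lt0r -lee_fin n0 andbT eq_sym -eqe.
have phi_le : (fundamental_function psi D <= (K / n)%:E)%E.
  apply: ge_ereal_sup => _ [p psi_p <-].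
  have := N_le _ psi_p; have [s -> s0] := psiE _ psi_p.
  rewrite inver gt_eqF// -!EFinM !lee_fin => n_le.
  rewrite ler_pdivlMr// mulrAC ler_pdivrMr//.
  have D1 : 0 < D `^ p^-1 by exact: powR_gt0.
  move: n_le; rewrite mulrAC ler_pdivlMr//.
  by rewrite mulrC.
move: phi_gt0 phi_le; case: (fundamental_function psi D) => [f|//|//].
rewrite lte_fin lee_fin => f0 f_le.
rewrite inver gt_eqF// -EFinM lee_fin ler_pdivlMr// mulrC -ler_pdivlMr//.
Qed.

End fundamental_function_bound.

Theorem theorem4p1 (R : realType) (disp : measure_display)
    (T : measurableType disp) (P : probability T R)
    (d : nat) (d_gt0 : (0 < d)%N)
    (xi : d.-tuple R -> T -> R)
    (xi_measurable : measurable_field xi)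
    (xi_separable : separable_field P xi)
    (alpha : 'I_d -> R) (alpha_gt0 : forall k, 0 < alpha k)
    (A : R) (B : \bar R)
    (theta_Psi : is_Psi_function (set_oo_outside A B (theta P xi alpha)) A B)
    (A_ge : (inf (range alpha))^-1 <= A)
    (delta : 'I_d -> R) (delta_in : forall k, 0 < delta k <= 1) :
  ('N[P]_(A%:E)[rect_modulus xi delta] <=
    (\prod_(k < d) delta k `^ alpha k)%:E /
    fundamental_function (set_oo_outside A B (theta P xi alpha))
      (\prod_(k < d) delta k))%E.
Proof.
have [[A1 AB] _ psi_itv _ psi_out] := theta_Psi.
have delta_gt0 k : 0 < delta k by case/andP: (delta_in k).
have A0 : 0 < A by exact: lt_le_trans A1.
(* 0 < inf alpha is needed to invert A_ge: the inverse of 0 is 0 *)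
have p_alpha p : A < p -> forall k, p^-1 < alpha k.
  move=> Ap k.
  pose m := \big[Num.min/1]_(j < d) alpha j.
  have m0 : 0 < m by apply: (big_ind (fun x => 0 < x)) => // x y; rewrite lt_min => -> ->.
  have m_le j : m <= alpha j by rewrite /m (bigD1 j)//= ge_min lexx.
  have m_inf : m <= inf (range alpha).
    apply: lb_le_inf; first by exists (alpha (Ordinal d_gt0)); exists (Ordinal d_gt0).
    by move=> _ [j _ <-].
  have inf_gt0 := lt_le_trans m0 m_inf.
  apply: (@lt_le_trans _ _ (inf (range alpha))).
    rewrite -[ltRHS]invrK ltf_pV2 ?posrE ?invr_gt0//; first exact: le_lt_trans Ap.
    exact: lt_trans Ap.
  by apply: ge_inf; [exists m => _ [j _ <-]|exists k].
have suppE p : supp (set_oo_outside A B (theta P xi alpha)) p ->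
    (A%:E < p%:E < B)%E.
  by rewrite /supp/=; apply: contraPT => /psi_out ->; rewrite ltxx.
have modulus_ge0 w : (0 <= rect_modulus xi delta w)%E.
  pose z := [tuple 0 : R | _ < d].
  have z01 : @unit_cube R d z by move=> k; rewrite tnth_mktuple lexx ler01.
  apply: (@le_trans _ _ `|rect_diff (xi^~ w) z z|%:E); first by rewrite lee_fin.
  apply: ereal_sup_ubound; exists (z, z) => //; split => //= k.
  by rewrite subrr normr0 ltW.
apply: le_div_fundamental_function.
- by apply: prodr_gt0 => k _; exact: powR_gt0.
- by apply: prodr_gt0 => k _.
- exact: Lnorm_ge0.
- have [p /andP[Ap pB]] : exists p : R, (A%:E < p%:E < B)%E.
    move: B AB {theta_Psi psi_itv psi_out suppE} => [b|_|//].
      rewrite lte_fin => Ab; exists ((A + b) / 2).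
      by rewrite !lte_fin; apply/andP; split; lra.
    by exists (A + 1); rewrite lte_fin ltrDl ltr01 ltry.
  by exists p; rewrite /supp/=; have := psi_itv p; rewrite Ap pB => /(_ isT)/andP[].
- by move=> p /suppE/psi_itv/andP[].
- move=> p /suppE pAB; have /andP[Ap pB] := pAB.
  rewrite lte_fin in Ap.
  have p1 : 1 <= p by rewrite (le_trans A1)// ltW.
  have pa := p_alpha p Ap.
  rewrite /set_oo_outside pAB.
  have -> : \prod_(k < d) delta k `^ alpha k / (\prod_(k < d) delta k) `^ p^-1 =
      \prod_(k < d) delta k `^ (alpha k - p^-1).
    rewrite powR_prod; last by move=> k; exact: ltW.
    rewrite -prodf_div; apply: eq_bigr => k _.
    by rewrite powRB// gt_eqF// implybT.
  rewrite -Lnorm_modulus_majorant//.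
  apply: Lnorm_le_Lnorm_majorant => //.
  + exact: measurable_modulus_majorant.
  + by move=> w; exact: modulus_majorant_ge0.
  apply: filterS (ae_rect_modulus_le_majorant P d xi xi_measurable alpha p
    xi_separable p1 pa delta delta_gt0) => w.
  by rewrite gee0_abs.
Qed.
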